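(* Let $d>4$, let $\Omega\subset\mathbb R^d$ be a (nonempty) bounded open set, let $\nu,\sigma_1,\sigma_2,\alpha_1,\alpha_2>0$ and $M_1,M_2\in SL(d,\mathbb R)$. Let $Y_1$ and $Y_2$ be two mean zero, geometric anisotropic $d$-dimensional Matérn Gaussian random fields defined on $\Omega$ with parameters $(\sigma_1,\alpha_1,\nu,M_1)$ and $(\sigma_2,\alpha_2,\nu,M_2)$, respectively. If $(\sigma_1,\alpha_1)\ne(\sigma_2,\alpha_2)$, or if there is no $O\in SO(d,\mathbb R)$ with $M_1=OM_2$, then the Gaussian measures induced by the random fields $Y_1$ and $Y_2$ are orthogonal (mutually singular).
   Context: A mean zero geometric anisotropic $d$-dimensional Matérn Gaussian random field on $\Omega$ with parameters $(\sigma,\alpha,\nu,M)$ is a mean zero Gaussian random field $\{Y(\boldsymbol t):\boldsymbol t\in\Omega\}$ with $\operatorname{cov}(Y(\boldsymbol s),Y(\boldsymbol t))=K(|M\boldsymbol s-M\boldsymbol t|)$, where $|\cdot|$ is the Euclidean norm, $K(t)=\frac{\sigma^2(\alpha t)^\nu}{\Gamma(\nu)2^{\nu-1}}\mathcal K_\nu(\alpha t)$ for $t>0$, $K(0)=\sigma^2$, and $\mathcal K_\nu$ is the modified Bessel function of the second kind of order $\nu$. $SL(d,\mathbb R)$ is the group of real $d\times d$ matrices of determinant 1 and $SO(d,\mathbb R)$ is the subgroup of orthogonal matrices in $SL(d,\mathbb R)$. The measure induced by a random field on $\Omega$ is its law on $\mathbb R^\Omega$ with the product $\sigma$-algebra.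 *)

(* Defs.v *)
From HB Require Import structures.
From mathcomp Require Import all_boot all_order all_algebra.
From mathcomp Require Import all_classical all_reals all_analysis.

Set Implicit Arguments.
Unset Strict Implicit.
Unset Printing Implicit Defensive.

Import Order.TTheory GRing.Theory Num.Theory.
Import numFieldNormedType.Exports.

Local Open Scope classical_set_scope.
Local Open Scope ring_scope.

Section special_functions.
Context {R : realType}.
Implicit Types nu x t : R.

Definition Gamma nu : R :=
  \int[lebesgue_measure]_(x in `]0, +oo[) (x `^ (nu - 1) * expR (- x)).

Definition cosh x : R := (expR x + expR (- x)) / 2.

(* Modified Bessel function of the second kind, by its integral
   representation K_nu(x) = int_0^oo exp(- x cosh t) cosh(nu t) dt,
   valid for x > 0 and every real order nu. *)
Definition besselK nu x : R :=
  \int[lebesgue_measure]_(t in `[0, +oo[) (expR (- x * cosh t) * cosh (nu * t)).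

(* Meant for t >= 0 only. *)
Definition matern (sigma alpha nu t : R) : R :=
  if t == 0 then sigma ^+ 2
  else sigma ^+ 2 * (alpha * t) `^ nu / (Gamma nu * 2 `^ (nu - 1)) *
       besselK nu (alpha * t).

End special_functions.

Section linear_groups.
Context {R : realType} {d : nat}.

(* The norm `|x| on matrices is the maximum norm. *)
Definition eucl_norm (x : 'cV[R]_d) : R := Num.sqrt (\sum_i x i 0 ^+ 2).

Definition SL : set 'M[R]_d := [set M | \det M = 1].

Definition SO : set 'M[R]_d := [set O | SL O /\ O^T *m O = 1%:M].

End linear_groups.

Arguments SL : clear implicits.
Arguments SO : clear implicits.

Definition cylinders (I : Type) (R : realType) : set (set (I -> R)) :=
  \bigcup_i preimage_set_system setT (fun f : I -> R => f i) measurable.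

(* R^I with its product sigma-algebra. *)
Notation path_space I R := (g_sigma_algebraType (@cylinders I R)).

Section random_fields.
Context {R : realType} {d : measure_display} {T : measurableType d}.
Context {P : probability T R} {I : Type}.

Definition sample_path (Y : I -> {RV P >-> R}) : T -> path_space I R :=
  fun w i => Y i w.

Lemma measurable_sample_path (Y : I -> {RV P >-> R}) :
  measurable_fun setT (sample_path Y).
Proof.
apply: (@measurability _ _ T (path_space I R) setT (sample_path Y)
  (@cylinders I R)) => //.
move=> _ [_ [i _ [B mB <-]] <-]; rewrite !setTI.
by rewrite -[_ @^-1` _]setTI; exact: (measurable_funPT (Y i)).
Qed.

HB.instance Definition _ (Y : I -> {RV P >-> R}) :=
  isMeasurableFun.Build _ _ _ _ (sample_path Y) (measurable_sample_path Y).

Definition law (Y : I -> {RV P >-> R}) : probability (path_space I R) R :=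
  distribution P (sample_path Y).

(* Normal law of mean m and standard deviation s, degenerate if s = 0 (the
   junk value normal_prob m 0 is the uniform law on [0, 1]). *)
Definition normal_law (m s : R) (A : set R) : \bar R :=
  if s == 0 then \d_m A else normal_prob m s A.

Definition is_gaussian (X : T -> R) : Prop :=
  exists m s : R, 0 <= s /\
    forall A : set R, measurable A -> pushforward P X A = normal_law m s A.

(* Every finite-dimensional marginal is a, possibly degenerate, multivariate
   normal vector: all its linear combinations are normal. *)
Definition gaussian_field (Y : I -> {RV P >-> R}) : Prop :=
  forall (n : nat) (t : 'I_n -> I) (a : 'I_n -> R),
    is_gaussian (fun w => \sum_(k < n) a k * Y (t k) w).

Definition mean_zero (Y : I -> {RV P >-> R}) : Prop :=
  forall t, ('E_P[Y t] = 0)%E.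

End random_fields.

Definition matern_field {R : realType} {d : measure_display}
    {T : measurableType d} {P : probability T R} {n : nat}
    (Omega : set 'cV[R]_n) (sigma alpha nu : R) (M : 'M[R]_n)
    (Y : Omega -> {RV P >-> R}) : Prop :=
  [/\ gaussian_field Y, mean_zero Y &
      forall s t : Omega, covariance P (Y s) (Y t) =
        (matern sigma alpha nu
           (eucl_norm (M *m set_val s - M *m set_val t)))%:E].

Definition mutually_singular {d : measure_display} {T : measurableType d}
    {R : realType} (mu1 mu2 : {measure set T -> \bar R}) : Prop :=
  exists A : set T, [/\ measurable A, mu1 A = 0%E & mu2 (~` A) = 0%E].

(* Main.v *)
Require Import Defs.
From HB Require Import structures.
From mathcomp Require Import all_boot all_order all_algebra.
From mathcomp Require Import all_classical all_reals all_analysis.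
From mathcomp Require Import measurable_realfun ring lra.
Import Order.TTheory GRing.Theory Num.Theory.
Import numFieldNormedType.Exports.
Local Open Scope classical_set_scope.
Local Open Scope ring_scope.

(** The Matern covariance is a Gaussian scale mixture: up to the factor
    kappa = sigma^2 alpha^(2 nu) / Gamma(nu), its value at distance t is the
    integral over r in R of exp(nu r - alpha^2 e^r - (t^2 / 4) e^(-r)).

    Fix a direction e, and take N = (n+1)^d disjoint segments of direction e,
    based at the points of a grid of mesh comparable to eps = const / (n+1);
    on each of them form a finite difference of high order p of the field, of
    step eps e, and let F be the sum of their squares. By the mixture formula
    the mean of F is
      N eps^(2 nu) kappa |M e|^(2 nu) G(alpha^2 |M e|^2 eps^2),
    where G is strictly decreasing with G(b) >= G(0) - C b and a slope bounded
    away from 0 near 0. As soon as kappa |M e|^(2 nu) or alpha^2 |M e|^2 differ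
    between the two fields, their means therefore differ by at least
    c N eps^(2 nu + 2). Such an e exists: otherwise M1 and M2 would be related
    by a similarity, hence, both determinants being 1, by a rotation, and then
    (sigma, alpha) would be the same.
    The p-th differences make the covariances of distinct increments summable,
    so that for a Gaussian field the variance of F is at most C N eps^(4 nu).
    Chebyshev's inequality bounds the probability of error of the test "is F
    close to its second mean" by a multiple of 1 / (N eps^4), of order
    n^(4 - d), which tends to 0 because d > 4; Borel-Cantelli concludes. *)

(** * The Matern covariance as a mixture of Gaussians *)

Section integrals_over_R.
Context {R : realType}.
Local Notation mu := (@lebesgue_measure R).

Lemma ge0_integral_shift (G : R -> R) (c : R) : continuous G -> (forall x, 0 <= G x) ->
  (\int[mu]_x (G x)%:E = \int[mu]_x (G (x + c))%:E)%E.
Proof.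
move=> cG G0.
have dF : derive1 (fun x : R => x + c) = cst 1.
  by apply/funext => x; rewrite derive1E derive_val addr0.
rewrite (@increasing_ge0_integration_by_substitutionT _ (fun x => x + c) G) //.
- by apply: eq_integral => x _; rewrite dF /= fctE/= mulr1.
- by move=> x y xy; rewrite ltrD2r.
- by rewrite dF => x; exact: cvg_cst.
- by rewrite dF; exact: is_cvg_cst.
- by rewrite dF; exact: is_cvg_cst.
- exact: cvg_addrr_Ny.
- exact: cvg_addrr.
Qed.

(** Cut the line at 0 and reflect the negative half. This is how the half-line integral defining
    [besselK] becomes an integral over the whole line. *)
Lemma ge0_integral_fold (G : R -> R) : continuous G -> (forall x, 0 <= G x) ->
  (\int[mu]_x (G x)%:E = \int[mu]_(x in `[0%R, +oo[) (G x + G (- x)%R)%:E)%E.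
Proof.
move=> cG G0; have mG : measurable_fun setT G by exact: continuous_measurable_fun.
have mGN : measurable_fun setT (fun x : R => G (- x)).
  by apply: (measurableT_comp mG); exact: measurable_funN.
under [RHS]eq_integral do rewrite EFinD.
rewrite ge0_integralD//=; last 4 first.
- by move=> x _; rewrite lee_fin.
- by apply/measurable_EFinP; exact: measurable_funTS.
- by move=> x _; rewrite lee_fin.
- by apply/measurable_EFinP; exact: measurable_funTS.
have := @ge0_integration_by_substitutionNy R G 0; rewrite oppr0 => <- //; last first.
  exact: continuous_subspaceT.
have -> : [set: R] = `]-oo, 0[ `|` `[0, +oo[.
  by rewrite -setCitvl setUv.
rewrite ge0_integral_setU//=.
- rewrite addeC integral_itv_bndo_bndc//.
  by apply/measurable_EFinP; exact: measurable_funTS.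
- by apply/measurable_EFinP; exact: measurable_funTS.
- by move=> x _; rewrite lee_fin.
- rewrite disj_set2E; apply/eqP/seteqP; split => y //= [].
  by rewrite !in_itv/= andbT => /lt_geF ->.
Qed.

(** The dominating function for all the integrals over the line below: mixtures, covariances of
    increments and normal moments. *)
Lemma integrable_expRN_norm (k : R) : 0 < k ->
  mu.-integrable setT (EFin \o (fun x : R => expR (- (k * `|x|)))).
Proof.
move=> k0.
have cf : continuous (fun x : R => expR (- (k * `|x|))).
  move=> x; apply: continuous_comp; last exact: continuous_expR.
  apply: cvgN; apply: cvgM; [exact: cvg_cst|exact: norm_continuous].
apply/integrableP; split.
  by apply/measurable_EFinP; exact: continuous_measurable_fun.
under eq_integral do rewrite /= ger0_norm ?expR_ge0//.
rewrite (ge0_symfun_integralT _ cf); last 2 first.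
- by move=> x; exact: expR_ge0.
- by move=> x /=; rewrite normrN.
rewrite -set_itvcy lte_mul_pinfty//.
rewrite (@ge0_continuous_FTC2y _ _ (fun x => - k^-1 * expR (- (k * x))) _ 0)//.
- by rewrite -EFinN -EFinD ltry.
- by apply: continuous_subspaceT => y; exact: cf.
- rewrite -(mulr0 (- k^-1)); apply: cvgM; first exact: cvg_cst.
  apply: (@cvg_comp _ _ _ (fun x => k * x) (fun y => expR (- y)) _ +oo); last exact: cvgr_expR.
  by apply: gt0_cvgMry.
- apply: cvg_at_right_filter; apply: cvgM; first exact: cvg_cst.
  apply: continuous_comp; last exact: continuous_expR.
  by apply: cvgN; apply: cvgM; [exact: cvg_cst|exact: cvg_id].
- move=> x; rewrite in_itv/= andbT => x0.
  rewrite derive1E derive_val.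
  rewrite ger0_norm ?ltW// /GRing.scale/=.
  by field; rewrite gt_eqF.
Qed.

(* After the substitution u = e^r, so that K_nu and Gamma become integrals over
   the whole line and a change of scale becomes a translation of r. *)
Definition mix_kernel (nu b q r : R) : R :=
  expR (nu * r - b * expR r - q * expR (- r)).

(** For b, q > 0 this is 2 (q / b)^(nu / 2) K_nu(2 sqrt(b q)). *)
Definition mixture (nu b q : R) : R := \int[mu]_r (mix_kernel nu b q r).

Lemma mix_kernel_ge0 nu b q r : 0 <= mix_kernel nu b q r.
Proof. exact: expR_ge0. Qed.

Lemma continuous_mix_kernel nu b q : continuous (mix_kernel nu b q).
Proof.
move=> x; apply: continuous_comp; last exact: continuous_expR.
apply: cvgB; first apply: cvgB.
- by apply: cvgM; [exact: cvg_cst|exact: cvg_id].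
- by apply: cvgM; [exact: cvg_cst|exact: continuous_expR].
- apply: cvgM; first exact: cvg_cst.
  by apply: continuous_comp; [exact: opp_continuous|exact: continuous_expR].
Qed.

Lemma mix_kernel_shift nu b q r c : 0 < c ->
  mix_kernel nu b q (r + ln c) = c `^ nu * mix_kernel nu (b * c) (q / c) r.
Proof.
move=> c0; rewrite /mix_kernel /powR gt_eqF// -expRD; congr expR.
rewrite opprD !expRD expRN lnK ?posrE// [expR (- ln c)]expRN lnK ?posrE//; ring.
Qed.

(** For infinite x both sides are 0, since [fine] sends infinities to 0. Hence constants can be
    taken out of a mixture before its integrability is known. *)
Lemma fineZ (r : R) (x : \bar R) : fine (r%:E * x)%E = r * fine x.
Proof.
case: x => [y| |] //=; rewrite mulr0 mulr_infty;
by case: (sgrP r) => _; rewrite ?mul0e// ?mul1e// EFinN ?mulN1e.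
Qed.

Lemma integral_mix_kernel_shift nu b q c : 0 < c ->
  (\int[mu]_r (mix_kernel nu b q r)%:E =
   (c `^ nu)%:E * \int[mu]_r (mix_kernel nu (b * c) (q / c) r)%:E)%E.
Proof.
move=> c0; rewrite (ge0_integral_shift _ (ln c) (continuous_mix_kernel nu b q) (mix_kernel_ge0 nu b q)).
under eq_integral do rewrite mix_kernel_shift// EFinM.
rewrite ge0_integralZl//.
- by apply/measurable_EFinP; apply: continuous_measurable_fun; exact: continuous_mix_kernel.
- by move=> x _; rewrite lee_fin mix_kernel_ge0.
- by rewrite lee_fin powR_ge0.
Qed.

(** The change of scale u -> c u, written additively. It brings the Matern function to its Bessel
    form, and later extracts the powers of the step and of |M e|. *)
Lemma mixture_shift nu b q c : 0 < c ->
  mixture nu b q = c `^ nu * mixture nu (b * c) (q / c).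
Proof.
move=> c0; rewrite /mixture /Rintegral (integral_mix_kernel_shift nu b q c c0).
by rewrite fineZ.
Qed.

(** Folding pairs r with -r: with b = q = x / 2 both kernels contain exp(- x cosh r), and exp(nu r)
    + exp(- nu r) = 2 cosh(nu r). *)
Lemma integral_besselK nu x :
  (\int[mu]_(t in `[0%R, +oo[) (expR (- x * cosh t) * cosh (nu * t))%:E =
   2^-1%:E * \int[mu]_r (mix_kernel nu (x / 2) (x / 2) r)%:E)%E.
Proof.
rewrite (ge0_integral_fold _ (continuous_mix_kernel _ _ _) (mix_kernel_ge0 _ _ _)).
rewrite -ge0_integralZl//; last 2 first.
- apply/measurable_EFinP; apply: measurable_funTS; apply: continuous_measurable_fun => y.
  apply: cvgD; first exact: continuous_mix_kernel.
  by apply: continuous_comp; [exact: opp_continuous|exact: continuous_mix_kernel].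
- by move=> y _; rewrite lee_fin addr_ge0// mix_kernel_ge0.
apply: eq_integral => t _; rewrite -EFinM; congr EFin.
rewrite /mix_kernel /cosh opprK.
rewrite (_ : nu * t - _ - _ = - x * ((expR t + expR (- t)) / 2) + nu * t); last by field.
rewrite (_ : nu * - t - _ - _ = - x * ((expR t + expR (- t)) / 2) - nu * t); last by field.
by rewrite !expRD; field.
Qed.

Lemma besselK_mixture nu x : besselK nu x = mixture nu (x / 2) (x / 2) / 2.
Proof.
by rewrite /besselK /Rintegral integral_besselK fineZ mulrC.
Qed.

(** The substitution x = e^r, carried out on the segments [-n, n], whose images [e^(-n), e^n]
    exhaust the open half-line; both sides then pass to the limit by monotone convergence. *)
Lemma Gamma_mixture nu : Gamma nu = mixture nu 1 0.
Proof.
rewrite /Gamma /mixture /Rintegral; congr fine.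
pose I n : set R := `[- n%:R, n%:R]%classic.
pose J n : set R := `[expR (- n%:R), expR n%:R]%classic.
have ndI : nondecreasing_seq I.
  move=> m n mn; rewrite subsetEset => x; rewrite /I /= !in_itv/= => /andP[mx xm].
  by rewrite (le_trans _ mx) ?(le_trans xm) ?lerN2 ?ler_nat.
have ndJ : nondecreasing_seq J.
  move=> m n mn; rewrite subsetEset => x; rewrite /J /= !in_itv/= => /andP[mx xm].
  by rewrite (le_trans _ mx) ?(le_trans xm) ?ler_expR ?lerN2 ?ler_nat.
have UI : \bigcup_n I n = setT.
  apply/seteqP; split => // x _; exists (Num.truncn `|x|).+1 => //.
  by rewrite /I /= in_itv/= -ler_norml; apply/ltW/truncnS_gt.
have UJ : \bigcup_n J n = `]0, +oo[%classic.
  apply/seteqP; split => x.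
    move=> [n _]; rewrite /J /= !in_itv/= andbT => /andP[+ _].
    by apply: lt_le_trans; rewrite expR_gt0.
  rewrite /= in_itv/= andbT => x0; have : (\bigcup_n I n) (ln x) by rewrite UI.
  move=> [n _]; rewrite /I /= in_itv/= => /andP[nx xn]; exists n => //.
  by rewrite /J /= in_itv/= -[x]lnK ?posrE// !ler_expR nx.
have E n : (\int[mu]_(x in J n) (x `^ (nu - 1) * expR (- x))%:E =
            \int[mu]_(x in I n) (mix_kernel nu 1 0 x)%:E)%E.
  have dE : derive1 (@expR R) = expR.
    by apply/funext => x; rewrite derive1E derive_val.
  rewrite integration_by_substitution_increasing//.
  - apply: eq_integral => x _ /=; rewrite dE fctE/=; congr EFin.
    rewrite /mix_kernel /powR gt_eqF ?expR_gt0// expRK -!expRD; congr expR.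
    ring.
  - by rewrite -subr_ge0 opprK -natrD ler0n.
  - by move=> x y _ _ xy; rewrite ltr_expR.
  - by rewrite dE => x _; exact: continuous_expR.
  - by apply/cvg_ex; exists (expR (- n%:R)); rewrite dE; apply: cvg_at_right_filter; exact: continuous_expR.
  - by apply/cvg_ex; exists (expR n%:R); rewrite dE; apply: cvg_at_left_filter; exact: continuous_expR.
  - split.
    + by move=> x _; exact: derivable_expR.
    + by apply: cvg_at_right_filter; exact: continuous_expR.
    + by apply: cvg_at_left_filter; exact: continuous_expR.
  - apply: continuous_in_subspaceT => x; rewrite inE/= in_itv/= => /andP[+ _].
    move=> /(lt_le_trans (expR_gt0 _)) x0.
    apply: cvgM.
      have /derivable1_diffP/differentiable_continuous : derivable (@powR R ^~ (nu - 1)) x 1.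
        by apply: derivable_powR; rewrite in_itv/= x0.
      exact.
    by apply: continuous_comp; [exact: opp_continuous|exact: continuous_expR].
have mI n : measurable (I n) by exact: measurable_itv.
have mJ n : measurable (J n) by exact: measurable_itv.
have hJ : (\int[mu]_(x in J i) (x `^ (nu - 1) * expR (- x))%:E @[i --> \oo] -->
   \int[mu]_(x in \bigcup_i J i) (x `^ (nu - 1) * expR (- x))%:E)%E.
  apply: ge0_nondecreasing_set_cvg_integral => //.
  - move=> n; apply/measurable_EFinP; apply: measurable_funTS.
    apply: measurable_funM; first exact: measurable_powR.
    by apply: measurableT_comp => //; exact: measurable_funN.
  - by move=> n x _; rewrite lee_fin mulr_ge0// ?powR_ge0 ?expR_ge0.
have hI : (\int[mu]_(x in I i) (mix_kernel nu 1 0 x)%:E @[i --> \oo] -->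
   \int[mu]_(x in \bigcup_i I i) (mix_kernel nu 1 0 x)%:E)%E.
  apply: ge0_nondecreasing_set_cvg_integral => //.
  - move=> n; apply/measurable_EFinP; apply: measurable_funTS.
    by apply: continuous_measurable_fun; exact: continuous_mix_kernel.
  - by move=> n x _; rewrite lee_fin mix_kernel_ge0.
rewrite -UJ -[X in _ = (\int[_]_(_ in X) _)%E]UI.
rewrite (funext E) in hJ; exact: cvg_unique hJ hI.
Qed.

(** For r < 0 the factor exp(nu r) suffices. For r >= 0, with n >= 2 nu, exp(2 nu r) <= (e^r)^n <=
    (n! / b^n) exp(b e^r), one term of the exponential series. *)
Lemma mix_kernel_le (nu b q r : R) : 0 < nu -> 0 < b -> 0 <= q ->
  mix_kernel nu b q r <=
  (1 + (Num.truncn (2 * nu)).+1`!%:R / b ^+ (Num.truncn (2 * nu)).+1) * expR (- (nu * `|r|)).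
Proof.
move=> nu0 b0 q0; set n := (Num.truncn (2 * nu)).+1.
have C0 : 0 <= n`!%:R / b ^+ n by rewrite divr_ge0// exprn_ge0// ltW.
have q1 : mix_kernel nu b q r <= expR (nu * r - b * expR r).
  by rewrite ler_expR gerBl mulr_ge0 ?expR_ge0.
apply: (le_trans q1); have [r0|r0] := ltP r 0.
  rewrite mulrDl mul1r -[leLHS]addr0 lerD ?(mulr_ge0 C0) ?expR_ge0//.
  by rewrite ler_expR ltr0_norm// mulrN opprK gerBl mulr_ge0 ?expR_ge0// ltW.
rewrite ger0_norm//; apply: (@le_trans _ _ (n`!%:R / b ^+ n * expR (- (nu * r)))); last first.
  by rewrite ler_wpM2r ?expR_ge0// lerDr.
rewrite (_ : nu * r - _ = - (nu * r) + (2 * nu * r) - b * expR r); last by ring.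
rewrite -addrA expRD [leRHS]mulrC ler_wpM2l ?expR_ge0// expRB.
rewrite ler_pdivrMr ?expR_gt0//.
have h1 : expR (2 * nu * r) <= expR r ^+ n.
  rewrite -expRM_natl ler_expR ler_wpM2r//; apply/ltW/truncnS_gt.
apply: (le_trans h1).
have be0 : 0 <= b * expR r by rewrite mulr_ge0 ?expR_ge0// ltW.
have := expR_ge1Dxn n.-1 be0; rewrite -/n.
move=> /(le_trans _) -/(_ ((b * expR r) ^+ n / n`!%:R)) h2.
rewrite mulrAC ler_pdivlMr ?exprn_gt0// mulrC.
rewrite -exprMn -ler_pdivrMl ?ltr0n ?fact_gt0// mulrC.
by apply: h2; rewrite lerDr.
Qed.

Lemma integrable_mix_kernel (nu b q : R) : 0 < nu -> 0 < b -> 0 <= q ->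
  mu.-integrable setT (EFin \o mix_kernel nu b q).
Proof.
move=> nu0 b0 q0.
apply: le_integrable (integrableZl _ (1 + (Num.truncn (2 * nu)).+1`!%:R / b ^+ (Num.truncn (2 * nu)).+1)
  (integrable_expRN_norm _ nu0)) => //.
  by apply/measurable_EFinP; apply: continuous_measurable_fun; exact: continuous_mix_kernel.
move=> r _ /=; rewrite lee_fin ger0_norm ?mix_kernel_ge0//.
rewrite [leRHS]ger0_norm; first exact: mix_kernel_le.
by rewrite mulr_ge0 ?expR_ge0// addr_ge0// divr_ge0// exprn_ge0// ltW.
Qed.

Lemma mixture_gt0 (nu b q : R) : 0 < nu -> 0 < b -> 0 <= q -> 0 < mixture nu b q.
Proof.
move=> nu0 b0 q0.
have I := integrable_mix_kernel nu b q nu0 b0 q0.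
apply: (@lt_le_trans _ _ (\int[mu]_(r in `[0%R, 1%R]) (cst (expR (- b * expR 1 - q)) r))).
  rewrite Rintegral_cst//= lebesgue_measure_itv/= lte01 oppr0 adde0 /= mulr1 expR_gt0//.
rewrite /mixture.
apply: (@le_trans _ _ (\int[mu]_(r in `[0%R, 1%R]) mix_kernel nu b q r)).
  apply: le_Rintegral => //.
  - apply: continuous_compact_integrable; first exact: segment_compact.
    by apply: continuous_subspaceT => x; exact: cvg_cst.
  - by apply: integrableS I.
  - move=> r; rewrite /= in_itv/= => /andP[r0 r1].
    rewrite ler_expR lerB//.
      rewrite mulNr -[leLHS]add0r lerB ?mulr_ge0 ?(ltW nu0)//.
      by rewrite ler_pM2l// ler_expR.
    by rewrite ler_piMr// expR_le1 oppr_le0.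
rewrite /Rintegral fine_le// ?integrable_fin_num//.
  by apply: integrableS I.
apply: ge0_subset_integral => //.
- by case/integrableP : I.
- by move=> r _; rewrite lee_fin mix_kernel_ge0.
Qed.

Lemma powRV (x a : R) : 0 <= x -> x^-1 `^ a = (x `^ a)^-1.
Proof. by move=> x0; rewrite -powR_inv1// -powRrM mulN1r powRN. Qed.

(** A change of scale in the mixture: by alpha^(-2) at t = 0, which leaves a Gamma integral, and by
    t / (2 alpha) for t > 0. *)
Lemma matern_mixture (sigma alpha nu t : R) : 0 < alpha -> 0 < nu -> 0 <= t ->
  matern sigma alpha nu t =
  sigma ^+ 2 * alpha `^ (2 * nu) / Gamma nu * mixture nu (alpha ^+ 2) (t ^+ 2 / 4).
Proof.
move=> a0 nu0 t0; have G0 : Gamma nu != 0 by rewrite Gamma_mixture gt_eqF// mixture_gt0.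
rewrite /matern; case: eqP => [->|/eqP tn0].
  rewrite (mixture_shift _ _ _ (alpha ^- 2)) ?invr_gt0 ?exprn_gt0//.
  rewrite expr0n/= !mul0r mulfV ?gt_eqF ?exprn_gt0// -Gamma_mixture.
  rewrite -(powR_invn 2) ?(ltW a0)// -powRrM mulNr powRN.
  field; rewrite G0 /= gt_eqF ?powR_gt0//.
have {tn0}t0 : 0 < t by rewrite lt0r tn0.
have [a0' t0'] : alpha != 0 /\ t != 0 by rewrite !gt_eqF.
(* This scale makes the two parameters of the mixture equal, both to alpha t / 2, as in
   [besselK_mixture]. *)
rewrite (mixture_shift _ _ _ (t / (2 * alpha))) ?divr_gt0 ?mulr_gt0// besselK_mixture.
rewrite (_ : alpha ^+ 2 * (t / _) = alpha * t / 2); last by field.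
rewrite (_ : t ^+ 2 / 4 / (t / _) = alpha * t / 2); last by field; rewrite a0' t0'.
rewrite !(powRM, powRV) ?invr_ge0 ?mulr_ge0 ?(ltW a0) ?(ltW t0)//.
rewrite (_ : 2 * nu = nu + nu); last by ring.
rewrite powRB ?pnatr_eq0 ?implybT// powRD ?a0' ?implybT// powRr1//.
by field; rewrite G0 !gt_eqF ?powR_gt0.
Qed.
End integrals_over_R.

(** * Finite differences of Gaussian functions *)

Section finite_differences.
Context {R : realType}.
Implicit Types (p : nat) (x h c s : R).

Definition diff_coef p j : R := (-1) ^+ j * 'C(p, j)%:R.

(** This is (1 - S)^p f with S the unit shift, that is, the forward difference up to the sign
    (-1)^p. *)
Definition fdiff p (f : R -> R) x : R := \sum_(j < p.+1) diff_coef p j * f (x + j%:R).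

(** Pascal's rule; one factor 1 - S is moved onto f. *)
Lemma fdiffS p f x : fdiff p.+1 f x = fdiff p (fun y => f y - f (y + 1)) x.
Proof.
rewrite /fdiff; under [RHS]eq_bigr do rewrite mulrBr.
rewrite sumrB big_ord_recl /= [X in _ = X - _]big_ord_recl /=.
rewrite /diff_coef !expr0 !bin0 !mul1r addr0 -addrA; congr (_ + _).
under eq_bigr => i _ do rewrite /bump leq0n add1n binS natrD mulrDr mulrDl.
rewrite big_split /= big_ord_recr /= bin_small// mulr0 mul0r addr0; congr (_ + _).
rewrite -sumrN; apply: eq_bigr => i _.
by rewrite exprS mulN1r !mulNr -natr1 addrA.
Qed.

(** Here [F k] is the k-th derivative of [F 0]. By induction each factor 1 - S costs one derivative,
    through the mean value theorem on [y, y + 1]. *)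
Lemma fdiff_le p (F : nat -> R -> R) (B : R) :
  (forall k y, (k < p)%N -> is_derive y (1 : R) (F k) (F k.+1 y)) ->
  (forall y, `|F p y| <= B) -> forall x, `|fdiff p (F 0%N) x| <= B.
Proof.
elim: p F => [|p IH] F dF FB x.
  by rewrite /fdiff big_ord1 /diff_coef expr0 bin0 !mul1r.
rewrite fdiffS; apply: (IH (fun k y => F k y - F k (y + 1))) => [k y kp|y].
  have dF1 := dF k (y + 1) (ltnW kp).
  have dF0 := dF k y (ltnW kp).
  apply: is_deriveB.
  rewrite -[F k.+1 _]mulr1; apply: (@is_derive1_comp R (F k) (fun z => z + 1)) => //.
  by apply: is_derive_eq; rewrite addr0.
have [] := @MVT R (F p) (F p.+1) y (y + 1).
- by rewrite ltrDl.
- by move=> z _; exact: dF.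
- apply: continuous_subspaceT => z; apply/differentiable_continuous/derivable1_diffP.
  exact: (@ex_derive _ _ _ _ _ _ _ (dF p z (ltnSn p))).
move=> c _; rewrite addrAC subrr add0r mulr1 distrC => ->.
exact: FB.
Qed.

(** For |y| > 1, |y|^k <= y^(2 k) <= k! exp(y^2); for |y| <= 1 the summand 1 is enough. *)
Lemma expr_gauss_le k (y : R) : `|y| ^+ k * expR (- y ^+ 2) <= 1 + k`!%:R.
Proof.
rewrite expRN ler_pdivrMr ?expR_gt0//.
set t := `|y|; have t0 : 0 <= t by exact: normr_ge0.
have -> : y ^+ 2 = t ^+ 2 by rewrite real_normK ?num_real.
have t1 : 1 <= expR (t ^+ 2) by rewrite -expR0 ler_expR exprn_ge0.
case: k => [|k]; first by rewrite expr0 (le_trans t1)// ler_peMl ?expR_ge0// lerDl.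
have tk : (t ^+ 2) ^+ k.+1 <= k.+1`!%:R * expR (t ^+ 2).
  rewrite mulrC -ler_pdivrMr ?ltr0n ?fact_gt0//.
  by apply: le_trans (expR_ge1Dxn k (exprn_ge0 2 t0)); rewrite lerDr.
rewrite mulrDl mul1r; have [t_le1|t_ge1] := leP t 1.
  rewrite (@le_trans _ _ 1)// ?exprn_ile1// -[leLHS]addr0 lerD// mulr_ge0// expR_ge0//.
rewrite -[leLHS]add0r lerD ?expR_ge0// (le_trans _ tk)// -exprM ler_eXn2l ?ltW//.
by rewrite leq_pmull.
Qed.

Lemma fdiff_gaussian_le p : exists2 B : R, 0 <= B &
  forall h c x, 0 <= h ->
    `|fdiff p (fun y => expR (- (h * y + c) ^+ 2)) x| <= B * h ^+ p.
Proof.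
(* Hermite polynomials up to sign: the k-th derivative of exp(- y^2) is [P k] times exp(- y^2).
   Being bounded on the whole line, it gives a B uniform in h, c and x. *)
pose P := fix P k : {poly R} := if k is k'.+1 then (P k')^`() - 2 *: ('X * P k') else 1.
have bnd (Q : {poly R}) : exists2 B : R, 0 <= B & forall y, `|Q.[y] * expR (- y ^+ 2)| <= B.
  exists (\sum_(i < size Q) `|Q`_i| * (1 + i`!%:R)).
    by apply: sumr_ge0 => i _; rewrite mulr_ge0.
  move=> y; rewrite horner_coef mulr_suml (le_trans (ler_norm_sum _ _ _))//.
  apply: ler_sum => i _; rewrite -mulrA normrM ler_wpM2l//.
  by rewrite normrM (ger0_norm (expR_ge0 _)) normrX expr_gauss_le.
have [B B0 PB] := bnd (P p).
exists B => // h c x h0.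
have := @fdiff_le p (fun k y => h ^+ k * ((P k).[h * y + c] * expR (- (h * y + c) ^+ 2))) (B * h ^+ p).
rewrite (_ : (fun y => h ^+ 0 * _) = (fun y => expR (- (h * y + c) ^+ 2))); last first.
  by apply/funext => y; rewrite expr0 mul1r hornerC mul1r.
apply.
- move=> k y _ /=.
  have dl : is_derive y (1 : R) (fun y => h * y + c) h.
    by apply: is_derive_eq; rewrite /GRing.scale/= mulr1 addr0.
  have dP := @is_derive1_comp R (horner (P k)) (fun y => h * y + c) y _ _ (is_derive_poly (P k) (h * y + c)) dl.
  have dg (z : R) : is_derive z (1 : R) (fun z => expR (- z ^+ 2)) (expR (- z ^+ 2) * (- (2 * z))).
    apply: (@is_derive1_comp _ expR (fun z => - z ^+ 2)).
    by apply: is_derive_eq; rewrite /GRing.scale/= mulr1 mulr_natl.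
  have dE := @is_derive1_comp R (fun z => expR (- z ^+ 2)) (fun y => h * y + c) y _ _ (dg (h * y + c)) dl.
  have dZ := is_deriveZ (h ^+ k) (is_deriveM dP dE).
  have -> : h ^+ k.+1 * (((P k)^`() - 2 *: ('X * P k)).[h * y + c] * expR (- (h * y + c) ^+ 2)) =
    h ^+ k *: ((P k).[h * y + c] *: (expR (- (h * y + c) ^+ 2) * - (2 * (h * y + c)) * h) +
      expR (- (h * y + c) ^+ 2) *: ((P k)^`().[h * y + c] * h)).
    by rewrite /GRing.scale/= !hornerE /= exprS; ring.
  exact: dZ.
- by move=> y; rewrite normrM mulrC [`|h ^+ p|]ger0_norm ?exprn_ge0// ler_wpM2r ?exprn_ge0.
Qed.
End finite_differences.

(** * Quadratic forms with a Gaussian kernel on the integers *)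

Section gaussian_gram.
Context {R : realType} (n : nat) (a : 'I_n -> R).

Definition gram (s : R) : R :=
  \sum_(j < n) \sum_(k < n) a j * a k * expR (- (s * (j%:R - k%:R) ^+ 2)).

(* Expanding the cross term exp(2 s j k) in powers of j k writes the quadratic
   form as a combination, with nonnegative coefficients, of squares. *)
Lemma gram_ge0 s : 0 <= s -> 0 <= gram s.
Proof.
move=> s0; pose b j := a j * expR (- (s * j%:R ^+ 2)).
have -> : gram s = \sum_(j < n) \sum_(k < n) b j * b k * expR (2 * s * j%:R * k%:R).
  apply: eq_bigr => j _; apply: eq_bigr => k _.
  rewrite /b mulrACA -!mulrA; congr (_ * (_ * _)); rewrite -!expRD; congr expR; ring.
pose u m := \sum_(j < n) \sum_(k < n) b j * b k * series (exp_coeff (2 * s * j%:R * k%:R)) m.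
have cu : u m @[m --> \oo] --> \sum_(j < n) \sum_(k < n) b j * b k * expR (2 * s * j%:R * k%:R).
  apply: cvg_big => [|j _]; first exact: add_continuous.
  apply: cvg_big => [|k _]; first exact: add_continuous.
  apply: cvgM; first exact: cvg_cst.
  exact: is_cvg_series_exp_coeff.
rewrite -(cvg_lim _ cu)//; apply: limr_ge; first by apply/cvg_ex; eexists; exact: cu.
apply: nearW => m.
rewrite (_ : u m = \sum_(0 <= i < m) (2 * s) ^+ i / i`!%:R * (\sum_(j < n) b j * j%:R ^+ i) ^+ 2).
  by apply: sumr_ge0 => i _; rewrite mulr_ge0 ?sqr_ge0 ?divr_ge0 ?exprn_ge0 ?mulr_ge0.
rewrite /u /series /=.
under eq_bigr do under eq_bigr do rewrite mulr_sumr.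
under eq_bigr do rewrite exchange_big.
rewrite exchange_big; apply: eq_bigr => i _ /=.
rewrite expr2 big_distrlr /= mulr_sumr; apply: eq_bigr => j _.
rewrite mulr_sumr; apply: eq_bigr => k _.
rewrite /exp_coeff /= !exprMn; ring.
Qed.

(** Distinct integers are at distance at least 1, so the off-diagonal terms add up to at most A
    exp(- s). This provides the strict positivity that [gram_ge0] does not. *)
Lemma gram_lim : exists s0 : R, forall s, s0 <= s -> \sum_j a j ^+ 2 - 2^-1 <= gram s.
Proof.
pose A := \sum_(j < n) \sum_(k < n) `|a j * a k|.
have A0 : 0 <= A by apply: sumr_ge0 => j _; apply: sumr_ge0.
exists (ln (2 * (A + 1))) => s hs.
have es : A * expR (- s) <= 2^-1.
  have A1 : 0 < 2 * (A + 1) by rewrite mulr_gt0// ltr_wpDl.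
  rewrite expRN ler_pdivrMr ?expR_gt0//.
  apply: (@le_trans _ _ (2^-1 * (2 * (A + 1)))); first by rewrite mulKf// lerDl.
  by rewrite ler_wpM2l// -ler_ln ?posrE ?expR_gt0// expRK.
rewrite lerBlDr -lerBlDl; apply: le_trans es.
rewrite /gram /A mulr_suml -sumrB; apply: ler_sum => j _.
rewrite (bigD1 j)//= [in leRHS](bigD1 j)//=.
rewrite subrr expr0n mulr0 oppr0 expR0 mulr1 opprD addNKr.
rewrite -[leLHS]add0r mulrDl lerD ?mulr_ge0 ?expR_ge0//.
rewrite -sumrN mulr_suml; apply: ler_sum => k kj.
apply: (le_trans (ler_norm _)); rewrite normrN normrM (ger0_norm (expR_ge0 _)).
rewrite ler_wpM2l// ler_expR lerN2.
have s0 : 0 <= s.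
  by apply: le_trans hs; rewrite ln_ge0// mulrDr mulr1 -[leLHS]add0r lerD ?mulr_ge0// ler1n.
rewrite -[leLHS]mulr1 ler_wpM2l//.
wlog jk : j k kj / (j < k)%N.
  move=> W; have /orP[jk|jk] : (j < k)%N || (k < j)%N by rewrite -neq_ltn eq_sym.
    exact: W.
  by rewrite -sqrrN opprB W// eq_sym.
rewrite -sqrrN opprB -natrB 1?ltnW// -natrX ler1n expn_gt0 subn_gt0 jk//.
Qed.
End gaussian_gram.

(** * Squared Euclidean norms and linear maps *)

Lemma Cauchy_Schwarz_sum (R : realType) (I : finType) (a b : I -> R) :
  (\sum_k a k * b k) ^+ 2 <= (\sum_k a k ^+ 2) * \sum_k b k ^+ 2.
Proof.
(* Lagrange's identity: this double sum is twice the difference of the two sides. *)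
have : 0 <= \sum_k \sum_l (a k * b l - a l * b k) ^+ 2.
  by apply: sumr_ge0 => k _; apply: sumr_ge0 => l _; exact: sqr_ge0.
have -> : \sum_k \sum_l (a k * b l - a l * b k) ^+ 2 =
    \sum_k \sum_l a k ^+ 2 * b l ^+ 2 + \sum_k \sum_l b k ^+ 2 * a l ^+ 2
    - 2 * \sum_k \sum_l (a k * b k) * (a l * b l).
  rewrite mulr_sumr -big_split -sumrB /=; apply: eq_bigr => k _.
  rewrite mulr_sumr -big_split -sumrB /=; apply: eq_bigr => l _; ring.
rewrite -!big_distrlr /= -expr2.
rewrite [X in _ + X - _]mulrC; lra.
Qed.

Section quadratic_forms.
Context {R : realType} {d : nat}.
Implicit Types u v w : 'cV[R]_d.

Definition sqn u : R := \sum_i u i 0 ^+ 2.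

Lemma sqn_ge0 u : 0 <= sqn u.
Proof. by apply: sumr_ge0 => i _; exact: sqr_ge0. Qed.

Lemma sqn_gt0 u : u != 0 -> 0 < sqn u.
Proof.
move=> u0; rewrite lt0r sqn_ge0 andbT; apply: contra u0 => /eqP.
move/psumr_eq0P => h; apply/eqP/matrixP => i j; rewrite ord1 mxE.
by apply/eqP; rewrite -sqrf_eq0 h// => k _; exact: sqr_ge0.
Qed.

Lemma sqnZ (c : R) u : sqn (c *: u) = c ^+ 2 * sqn u.
Proof. by rewrite /sqn mulr_sumr; apply: eq_bigr => i _; rewrite mxE exprMn. Qed.

Lemma eucl_norm_sqr u : eucl_norm u ^+ 2 = sqn u.
Proof. by rewrite sqr_sqrtr// sqn_ge0. Qed.

Lemma eucl_norm_ge0 u : 0 <= eucl_norm u.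
Proof. exact: sqrtr_ge0. Qed.

(** Completing the square in y. Along a line a d-dimensional Gaussian is thus a one-dimensional one
    times a constant at most 1. *)
Lemma sqn_line u w : w != 0 -> exists y0 rest : R, 0 <= rest /\
  forall y : R, sqn (u + y *: w) = sqn w * (y + y0) ^+ 2 + rest.
Proof.
move=> w0; pose ip := \sum_i u i 0 * w i 0.
have W0 : sqn w != 0 by rewrite gt_eqF// sqn_gt0.
have E y : sqn (u + y *: w) = sqn u + 2 * y * ip + y ^+ 2 * sqn w.
  rewrite /sqn /ip !mulr_sumr -!big_split /=; apply: eq_bigr => i _.
  by rewrite !mxE; ring.
exists (ip / sqn w), (sqn (u + (- (ip / sqn w)) *: w)); split; first exact: sqn_ge0.
by move=> y; rewrite !E; field.
Qed.

Lemma sqn_mulmx_lb (M : 'M[R]_d) : M \in unitmx ->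
  exists2 c : R, 0 < c & forall v, c * sqn v <= sqn (M *m v).
Proof.
(* The squared Hilbert-Schmidt norm of the inverse bounds its operator norm; the summand 1 keeps K
   positive. *)
move=> uM; pose N := invmx M; pose K := 1 + \sum_i \sum_k N i k ^+ 2.
have K1 : 0 < K.
  by rewrite ltr_wpDr//; apply: sumr_ge0 => i _; apply: sumr_ge0 => k _; exact: sqr_ge0.
exists K^-1; first by rewrite invr_gt0.
move=> v; rewrite ler_pdivrMl//.
have -> : sqn v = sqn (N *m (M *m v)) by rewrite mulKmx.
move: (M *m v) => w; apply: (@le_trans _ _ ((\sum_i \sum_k N i k ^+ 2) * sqn w)); last first.
  by rewrite ler_wpM2r ?sqn_ge0// lerDr.
rewrite [leLHS]/sqn mulr_suml; apply: ler_sum => i _; rewrite mxE.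
exact: Cauchy_Schwarz_sum (N i) (fun k => w k 0).
Qed.
End quadratic_forms.

(** * Covariances of increments for a Gaussian kernel *)

Section increments.
Context {R : realType} {d : nat}.
Implicit Types u v w : 'cV[R]_d.

(** The covariance of two p-th differences of step w, based at points that differ by u, for the
    covariance function exp(- s |x|^2). *)
Definition gauss_incr p u w (s : R) : R :=
  \sum_(j < p.+1) \sum_(k < p.+1) diff_coef p j * diff_coef p k *
    expR (- (s * sqn (u + (j%:R - k%:R) *: w))).

Let weight p : R := \sum_(k < p.+1) `|diff_coef p k|.

(** For fixed k the sum over j is a p-th difference of a Gaussian along a line, which [sqn_line]
    makes one-dimensional with scale h = sqrt(s |w|^2). Only one of the two differences is
    exploited; the other is bounded by its weights. *)
Lemma gauss_incr_le p w : w != 0 -> exists2 B : R, 0 <= B &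
  forall u (s : R), 0 <= s -> `|gauss_incr p u w s| <= B * Num.sqrt (s * sqn w) ^+ p.
Proof.
move=> w0; have [B B0 hB] := @fdiff_gaussian_le R p.
exists (weight p * B) => [|u s s0]; first by rewrite mulr_ge0// sumr_ge0.
rewrite /gauss_incr exchange_big -mulrA mulr_suml (le_trans (ler_norm_sum _ _ _))//.
apply: ler_sum => k _; have [y0 [rest [rest0 E]]] := @sqn_line R d (u - k%:R *: w) w w0.
set h := Num.sqrt _.
have -> : \sum_(j < p.+1) diff_coef p j * diff_coef p k * expR (- (s * sqn (u + (j%:R - k%:R) *: w))) =
    diff_coef p k * (expR (- (s * rest)) * fdiff p (fun y => expR (- (h * y + h * y0) ^+ 2)) 0).
  rewrite /fdiff !mulr_sumr; apply: eq_bigr => j _.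
  rewrite add0r (mulrC (diff_coef p j)) -mulrA; congr (_ * _).
  rewrite mulrCA; congr (_ * _); rewrite -expRD; congr expR.
  have -> : u + (j%:R - k%:R) *: w = u - k%:R *: w + j%:R *: w.
    by rewrite scalerBl [_ - _ in LHS]addrC addrA.
  rewrite E -mulrDr exprMn.
  rewrite sqr_sqrtr ?mulr_ge0 ?sqn_ge0//; ring.
rewrite normrM ler_wpM2l// normrM (ger0_norm (expR_ge0 _)).
rewrite -[leRHS]mul1r ler_pM ?expR_ge0//.
  by rewrite expR_le1 oppr_le0 mulr_ge0.
by apply: hB; exact: sqrtr_ge0.
Qed.

Lemma gauss_incr_decay p u w (s m : R) : 0 <= s ->
  (forall j k, (j <= p)%N -> (k <= p)%N -> m <= sqn (u + (j%:R - k%:R) *: w)) ->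
  `|gauss_incr p u w s| <= weight p ^+ 2 * expR (- (s * m)).
Proof.
move=> s0 hm; rewrite /gauss_incr expr2 mulr_suml mulr_suml.
rewrite (le_trans (ler_norm_sum _ _ _))//; apply: ler_sum => j _.
rewrite mulr_sumr mulr_suml (le_trans (ler_norm_sum _ _ _))//; apply: ler_sum => k _.
rewrite !normrM (ger0_norm (expR_ge0 _)) ler_wpM2l ?mulr_ge0// ler_expR lerN2 ler_wpM2l//.
by apply: hm; rewrite -ltnS.
Qed.

(* The geometric mean of the bounds gauss_incr_le (small s) and
   gauss_incr_decay (distant segments), whence the order 4 q. *)
Lemma gauss_incr_min q w : w != 0 -> exists2 C : R, 0 <= C &
  forall u (s m : R), 0 <= s -> 0 <= m ->
  (forall j k, (j <= 4 * q)%N -> (k <= 4 * q)%N -> m <= sqn (u + (j%:R - k%:R) *: w)) ->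
  `|gauss_incr (4 * q)%N u w s| <= C * Num.min 1 (s ^+ q) * expR (- (s * m / 2)).
Proof.
move=> w0; have [B B0 hB] := gauss_incr_le (4 * q)%N w w0.
set A := weight (4 * q)%N ^+ 2; have A0 : 0 <= A by exact: sqr_ge0.
(* The summand 1 gives C <= C^2, as the case s^q < 1 compares squares. *)
pose C := A + A * B * sqn w ^+ (2 * q) + 1.
have ABW : 0 <= A * B * sqn w ^+ (2 * q).
  by rewrite mulr_ge0 ?exprn_ge0 ?sqn_ge0// mulr_ge0.
have C1 : 1 <= C by rewrite /C lerDr addr_ge0.
have C0 : 0 <= C by exact: le_trans C1.
exists C => // u s m s0 m0 hm.
have := gauss_incr_decay _ _ _ _ _ s0 hm; rewrite -/A.
have := hB u s s0; set X := `|_|; set E := expR (- (s * m / 2)).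
have E0 : 0 <= E by exact: expR_ge0.
have EE : expR (- (s * m)) = E ^+ 2 by rewrite -expRM_natl; congr expR; field.
have E1 : E <= 1 by rewrite expR_le1 oppr_le0 divr_ge0// mulr_ge0.
rewrite EE mulnC (mulnA q 2 2) mulnC exprM sqr_sqrtr ?mulr_ge0 ?sqn_ge0// exprMn => h1 h2.
have X0 : 0 <= X by exact: normr_ge0.
have s2 : s ^+ (q * 2) = (s ^+ q) ^+ 2 by rewrite exprM.
have [sq1|sq1] := leP 1 (s ^+ q).
  rewrite mulr1; apply: (le_trans h2).
  apply: ler_pM => //; [exact: sqr_ge0| |].
    by rewrite /C -addrA lerDl addr_ge0.
  by rewrite expr2 ler_piMl.
have sq0 : 0 <= s ^+ q by exact: exprn_ge0.
(* With X bounded by B (s |w|^2)^(2 q) and by A E^2, the product bounds X^2 by a constant times (s^q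
   E)^2. *)
rewrite -ler_sqr ?nnegrE ?mulr_ge0//.
rewrite [leLHS]expr2; apply: (le_trans (ler_pM X0 X0 h1 h2)).
rewrite s2 !exprMn [leRHS]mulrAC.
rewrite (_ : B * _ * _ = A * B * sqn w ^+ (q * 2) * (E ^+ 2 * (s ^+ q) ^+ 2)); last by ring.
rewrite -[leRHS]mulrA ler_wpM2r ?mulr_ge0 ?sqr_ge0//.
apply: (@le_trans _ _ C).
  by rewrite /C mulnC addrC addrA lerDr addr_ge0.
by rewrite expr2 ler_peMl.
Qed.
End increments.

(** * Increments based at the points of a grid *)

Section grid.
Context {R : realType} {d : nat}.

Definition grid_vec (L : R) (z : 'I_d -> nat) : 'cV[R]_d := \col_i (L * (z i)%:R).

(* For L large the segments based at distinct grid points are as far apart as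
   their indices. *)
Lemma grid_sep (p : nat) (e : 'cV[R]_d) : exists2 L : R, 0 <= L &
  forall (z w : 'I_d -> nat) j k, (j <= p)%N -> (k <= p)%N ->
  \sum_i ((z i)%:R - (w i)%:R) ^+ 2 <= sqn (grid_vec L z - grid_vec L w + (j%:R - k%:R) *: e).
Proof.
pose K := \sum_i `|e i 0|; have K0 : 0 <= K by exact: sumr_ge0.
(* The term in e moves a coordinate by at most p K. Where the indices z and w differ they do so by
   at least 1, so the excess p K in L compensates for it. *)
exists (1 + p%:R * K) => [|z w j k jp kp]; first by rewrite addr_ge0// mulr_ge0.
apply: ler_sum => i _; rewrite !mxE -mulrBr.
have [->|zw] := eqVneq (z i) (w i); first by rewrite subrr expr0n sqr_ge0.
rewrite -[leLHS]real_normK ?num_real// -[leRHS]real_normK ?num_real//.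
rewrite ler_sqr ?nnegrE//.
have zw1 : 1 <= `|(z i)%:R - (w i)%:R| :> R.
  have /orP[lt|lt] : (z i < w i)%N || (w i < z i)%N by rewrite -neq_ltn.
    by rewrite distrC -natrB 1?ltnW// normr_nat ler1n subn_gt0.
  by rewrite -natrB 1?ltnW// normr_nat ler1n subn_gt0.
have jk : `|(j%:R - k%:R) * e i 0| <= p%:R * K.
  rewrite normrM ler_pM//.
    have /orP[jk|jk] := leq_total j k.
      by rewrite distrC -natrB// normr_nat ler_nat (leq_trans (leq_subr _ _)).
    by rewrite -natrB// normr_nat ler_nat (leq_trans (leq_subr _ _)).
  by rewrite /K (bigD1 i)//= lerDl sumr_ge0.
apply: le_trans (lerB_normD _ _).
rewrite lerBrDr [leRHS]normrM [`|1 + _|]ger0_norm ?addr_ge0 ?mulr_ge0//.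
rewrite [leRHS]mulrDl mul1r lerD2l (le_trans jk)// ler_peMr// mulr_ge0//.
Qed.

(** A majorant of the Gaussian. Unlike the Gaussian, it grows by a factor of at most e^r when c is
    divided by e^r >= 1, and this loss can be paid by a power of s. *)
Definition decay (c : R) (x : R) : R := (1 + c * x ^+ 2)^-1.

Lemma expRN_decay (c x s : R) : 0 <= c -> 0 <= s -> expR (- (s * c * x ^+ 2)) <= decay (s * c) x.
Proof.
move=> c0 s0; rewrite /decay expRN lef_pV2 ?posrE ?expR_gt0 ?expR_ge1Dx//.
by rewrite ltr_wpDr// mulr_ge0 ?sqr_ge0// mulr_ge0.
Qed.

(** With s = e^(-r) / 4. For r <= 0, s >= 1/4 and the decay rate is at least c / 8. For r > 0 the
    product of the d decays costs e^(d r) and the weight at most 2 e^((nu + 1) r); the factor s^q <=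
    e^(- q r) pays for both and leaves e^(- nu r), by the choice of q. The weight 1 + e^r serves an
    integrand and its derivative in b at once. *)
Lemma gauss_incr_grid (nu c : R) (q : nat) (M : 'M[R]_d) (e : 'cV[R]_d) (L : R) :
  0 < nu -> M *m e != 0 -> 0 <= c -> 2 * nu + 1 + d%:R <= q%:R ->
  (forall (z w : 'I_d -> nat) j k, (j <= 4 * q)%N -> (k <= 4 * q)%N ->
    c * \sum_i ((z i)%:R - (w i)%:R) ^+ 2 <=
    sqn (M *m (grid_vec L z - grid_vec L w) + (j%:R - k%:R) *: (M *m e))) ->
  exists2 C : R, 0 <= C & forall (z w : 'I_d -> nat) (r : R),
    expR (nu * r) * (1 + expR r) *
    `|gauss_incr (4 * q)%N (M *m (grid_vec L z - grid_vec L w)) (M *m e) (expR (- r) / 4)| <=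
    C * (\prod_(i < d) decay (c / 8) ((z i)%:R - (w i)%:R)) * expR (- (nu * `|r|)).
Proof.
move=> nu0 e0 c0 hq hm; have [C C0 hC] := gauss_incr_min q (M *m e) e0.
exists (2 * C) => [|z w r]; first by rewrite mulr_ge0.
set D := `|_|; pose P := \prod_(i < d) decay (c / 8) ((z i)%:R - (w i)%:R).
rewrite -/P.
have P0 : 0 <= P by apply: prodr_ge0 => i _; rewrite invr_ge0 addr_ge0// mulr_ge0 ?sqr_ge0// divr_ge0.
pose s := expR (- r) / 4; have s0 : 0 <= s by rewrite divr_ge0// expR_ge0.
have hD : D <= C * Num.min 1 (s ^+ q) *
    expR (- (s * (c * \sum_i ((z i)%:R - (w i)%:R) ^+ 2) / 2)).
  apply: hC => //; last by move=> j k jp kp; exact: hm.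
  by rewrite mulr_ge0// sumr_ge0// => i _; exact: sqr_ge0.
have hE : expR (- (s * (c * \sum_i ((z i)%:R - (w i)%:R) ^+ 2) / 2)) <=
    \prod_(i < d) decay (s * (c / 2)) ((z i)%:R - (w i)%:R).
  rewrite (_ : - (s * _ / 2) = \sum_i - (s * (c / 2) * ((z i)%:R - (w i)%:R) ^+ 2)); last first.
    by rewrite sumrN -mulr_sumr; congr (- _); field.
  rewrite expR_sum; apply: ler_prod => i _; rewrite expR_ge0/=.
  by apply: expRN_decay => //; rewrite divr_ge0.
have den0 (a x : R) : 0 <= a -> 0 < 1 + a * x ^+ 2.
  by move=> a0; rewrite ltr_wpDr// mulr_ge0 ?sqr_ge0.
have [r0|r0] := leP r 0.
  rewrite (ler0_norm r0) mulrN opprK.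
  have hP : \prod_(i < d) decay (s * (c / 2)) ((z i)%:R - (w i)%:R) <= P.
    apply: ler_prod => i _; rewrite invr_ge0 ltW ?den0 ?mulr_ge0 ?divr_ge0//=.
    rewrite lef_pV2 ?posrE ?den0 ?divr_ge0 ?mulr_ge0 ?divr_ge0// lerD2l ler_wpM2r ?sqr_ge0//.
    rewrite (_ : c / 8 = 4^-1 * (c / 2)); last by field.
    by rewrite ler_wpM2r ?divr_ge0// /s -[leLHS]mul1r ler_wpM2r// -expR0 ler_expR oppr_ge0.
  have D1 : D <= C * P.
    apply: (le_trans hD); apply: ler_pM; rewrite ?expR_ge0 ?(le_trans hE)//.
      by rewrite mulr_ge0// le_min ler01 exprn_ge0.
    by rewrite -[leRHS]mulr1 ler_wpM2l// ge_min lexx.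
  have e1 : 1 + expR r <= 2 by rewrite (_ : 2 = 1 + 1)// lerD2l -expR0 ler_expR.
  rewrite [leRHS]mulrC -[leLHS]mulrA ler_wpM2l ?expR_ge0// -[leRHS]mulrA.
  by apply: ler_pM; rewrite ?addr_ge0 ?expR_ge0// /D normr_ge0.
rewrite (ger0_norm (ltW r0)).
have hP : \prod_(i < d) decay (s * (c / 2)) ((z i)%:R - (w i)%:R) <= expR (d%:R * r) * P.
  have -> : expR (d%:R * r) = \prod_(i < d) expR r.
    by rewrite prodr_const card_ord expRM_natl.
  rewrite -big_split /=; apply: ler_prod => i _.
  rewrite invr_ge0 ltW ?den0 ?mulr_ge0 ?divr_ge0//=.
  rewrite /decay -[X in _ <= X * _]invrK -invfM lef_pV2 ?posrE ?mulr_gt0 ?invr_gt0 ?expR_gt0 ?den0 ?divr_ge0 ?mulr_ge0 ?divr_ge0//.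
  rewrite mulrDr mulr1 -expRN lerD//; first by rewrite expR_le1 oppr_le0 ltW.
  by rewrite (_ : expR (- r) * _ = s * (c / 2) * ((z i)%:R - (w i)%:R) ^+ 2)// /s; field.
have hs : Num.min 1 (s ^+ q) <= expR (- (q%:R * r)).
  rewrite ge_min; apply/orP; right; rewrite -mulrN expRM_natl.
  by apply: lerXn2r; rewrite ?nnegrE ?expR_ge0// /s ler_pdivrMr// ler_peMr ?expR_ge0// ler1n.
have D1 : D <= C * expR (- (q%:R * r)) * (expR (d%:R * r) * P).
  apply: (le_trans hD); apply: ler_pM; rewrite ?expR_ge0 ?(le_trans hE)//.
    by rewrite mulr_ge0// le_min ler01 exprn_ge0.
  by rewrite ler_wpM2l.
have e1 : 1 + expR r <= 2 * expR r.
  have : 1 <= expR r by rewrite -expR0 ler_expR ltW.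
  lra.
apply: (@le_trans _ _ (expR (nu * r) * (2 * expR r) * (C * expR (- (q%:R * r)) * (expR (d%:R * r) * P)))).
  by apply: ler_pM; rewrite ?mulr_ge0 ?addr_ge0 ?expR_ge0 ?normr_ge0// ler_wpM2l ?expR_ge0.
rewrite (_ : _ * _ = 2 * C * P * (expR (nu * r) * expR r * expR (- (q%:R * r)) * expR (d%:R * r))); last by ring.
rewrite ler_wpM2l ?mulr_ge0// -!expRD ler_expR.
rewrite -subr_ge0 (_ : _ - _ = (q%:R - (2 * nu + 1 + d%:R)) * r); last by ring.
by rewrite mulr_ge0 ?subr_ge0// ltW.
Qed.

(** The bound is uniform in n and k: each distance |j - k| occurs at most twice, and [decay] at m >=
    1 is at most 1 / (c m^2). *)
Lemma sum_decay_le (c : R) : 0 < c -> exists2 S : R, 0 <= S &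
  forall n k, (k < n)%N -> \sum_(j < n) decay c (j%:R - k%:R) ^+ 2 <= S.
Proof.
move=> c0; pose h (m : nat) := decay c m%:R.
have den0 (x : R) : 0 < 1 + c * x ^+ 2 by rewrite ltr_wpDr// mulr_ge0 ?sqr_ge0// ltW.
have h0 m : 0 <= h m by rewrite invr_ge0 ltW.
have hc m : h m.+1 <= c^-1 * (m.+1%:R ^+ 2)^-1.
  rewrite -invfM lef_pV2 ?posrE ?den0 ?mulr_gt0 ?exprn_gt0 ?ltr0n//.
  by rewrite lerDr.
have h1 m : h m <= 1 by rewrite invf_le1 ?den0// lerDl mulr_ge0 ?sqr_ge0// ltW.
have H n : \sum_(m < n) h m <= 1 + 2 / c.
  (* Telescoping with 1 / (m (m + 1)). At m = 0 the inverse is 0 by convention, and the bound reads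
     2. *)
  have tel (m : nat) : \sum_(i < m) (i.+1%:R ^+ 2)^-1 <= 2 - m%:R^-1 :> R.
    elim: m => [|[|m] IH]; first by rewrite big_ord0 invr0 subr0.
      by rewrite big_ord1 expr1n invr1; lra.
    rewrite big_ord_recr /= (le_trans (lerD IH (lexx _)))//.
    rewrite -addrA lerD2l -lerBrDl opprK -[m.+2%:R]natr1; set x : R := m.+1%:R.
    have x0 : 0 < x by rewrite ltr0n.
    have x1 : 0 < x + 1 by rewrite addr_gt0.
    rewrite -subr_ge0 (_ : _ - _ = (x * (x + 1) ^+ 2)^-1).
      by rewrite invr_ge0 mulr_ge0 ?exprn_ge0 ?ltW.
    by field; rewrite !gt_eqF.
  case: n => [|n]; first by rewrite big_ord0 addr_ge0// divr_ge0// ltW.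
  rewrite big_ord_recl lerD//; apply: (@le_trans _ _ (c^-1 * \sum_(i < n) (i.+1%:R ^+ 2)^-1)).
    by rewrite mulr_sumr; apply: ler_sum => i _; exact: hc.
  rewrite mulrC ler_wpM2r ?invr_ge0 ?(ltW c0)// (le_trans (tel n))// gerBl invr_ge0//.
exists (2 * (1 + 2 / c)) => [|n k kn]; first by rewrite mulr_ge0// addr_ge0// divr_ge0// ltW.
have E (j : nat) : decay c (j%:R - k%:R) ^+ 2 <= if (j <= k)%N then h (k - j)%N else h (j - k)%N.
  apply: (@le_trans _ _ (decay c (j%:R - k%:R))).
    by rewrite expr2 ler_piMl ?invr_ge0 ?(ltW (den0 _))// invf_le1 ?den0// lerDl mulr_ge0 ?sqr_ge0// ltW.
  by case: leqP => [jk|/ltnW kj]; rewrite /h natrB// /decay -sqrrN opprB.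
apply: (@le_trans _ _ (\sum_(j < n) if (j <= k)%N then h (k - j)%N else h (j - k)%N)).
  by apply: ler_sum => j _; exact: E.
(* The sum is cut after j = k; each piece becomes a partial sum of h, the first one read
   backwards. *)
rewrite -(big_mkord xpredT (fun j : nat => if (j <= k)%N then h (k - j)%N else h (j - k)%N)).
rewrite (@big_cat_nat _ _ _ k.+1)//= mulr_natl mulr2n lerD//.
  rewrite big_nat_rev /= add0n (eq_big_nat _ _ (F2 := h)) ?big_mkord// => j /andP[_ jk].
  by rewrite subSS leq_subr subKn.
rewrite -{1}[k.+1]add0n big_addn (eq_big_nat _ _ (F2 := fun j => h j.+1)) => [|j _]; last first.
  by rewrite addnS ltnNge leq_addl /= subSn ?leq_addl// addnK.
apply: le_trans (H (n - k.+1).+1); rewrite big_ord_recl big_mkord.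
by rewrite -[leLHS]add0r lerD// /h invr_ge0 ltW.
Qed.
End grid.

(** * Linearity, domination and positivity of real integrals *)

Section Rintegral_facts.
Context {d : measure_display} {T : measurableType d} {R : realType}.
Variable mu : {measure set T -> \bar R}.

Lemma Rintegral_lincomb (I : Type) (s : seq I) (c : I -> R) (f : I -> T -> R) :
  (forall i, mu.-integrable setT (EFin \o f i)) ->
  mu.-integrable setT (EFin \o (fun x => \sum_(i <- s) c i * f i x)) /\
  \int[mu]_x (\sum_(i <- s) c i * f i x) = \sum_(i <- s) c i * \int[mu]_x (f i x).
Proof.
move=> fi; elim: s => [|i s [IH1 IH2]].
  under [X in EFin \o X]eq_fun do rewrite big_nil.
  rewrite big_nil; split; first exact: integrable0.
  under eq_Rintegral do rewrite big_nil.
  by rewrite /Rintegral integral0.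
have ci : mu.-integrable setT (EFin \o (fun x => c i * f i x)).
  by have := integrableZl measurableT (c i) (fi i); exact.
split.
  under [X in EFin \o X]eq_fun do rewrite big_cons.
  by have := integrableD measurableT ci IH1; exact.
under eq_Rintegral do rewrite big_cons.
by rewrite RintegralD// RintegralZl// IH2 big_cons.
Qed.

Lemma Rintegral_norm_le (f g : T -> R) :
  measurable_fun setT f -> mu.-integrable setT (EFin \o g) ->
  (forall x, `|f x| <= g x) ->
  mu.-integrable setT (EFin \o f) /\ `|\int[mu]_x f x| <= \int[mu]_x g x.
Proof.
move=> mf ig fg; have fi : mu.-integrable setT (EFin \o f).
  apply: le_integrable ig => //; first exact/measurable_EFinP.
  by move=> x _ /=; rewrite lee_fin (le_trans (fg x))// ler_norm.
split=> //; apply: (le_trans (le_normr_Rintegral measurableT fi)).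
by apply: le_Rintegral => //; exact: integrable_norm.
Qed.
End Rintegral_facts.

Lemma Rintegral_gt0 (R : realType) (h : R -> R) (a delta : R) :
  (@lebesgue_measure R).-integrable setT (EFin \o h) -> (forall r, 0 <= h r) -> 0 < delta ->
  (forall r, a <= r <= a + 1 -> delta <= h r) -> 0 < \int[lebesgue_measure]_r h r.
Proof.
move=> hi h0 d0 hd.
apply: (@lt_le_trans _ _ (\int[lebesgue_measure]_(r in `[a, a + 1]) (cst delta r))).
  rewrite Rintegral_cst//= lebesgue_measure_itv/= lte_fin ltrDl ltr01 -EFinB addrAC subrr add0r.
  by rewrite mulr1.
apply: (@le_trans _ _ (\int[lebesgue_measure]_(r in `[a, a + 1]) h r)).
  apply: le_Rintegral => //.
  - apply: continuous_compact_integrable; first exact: segment_compact.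
    by apply: continuous_subspaceT => x; exact: cvg_cst.
  - by apply: integrableS hi.
rewrite /Rintegral fine_le// ?integrable_fin_num//; first by apply: integrableS hi.
apply: ge0_subset_integral => //; first by case/integrableP : hi.
by move=> r _; rewrite lee_fin.
Qed.

(** * Covariances of increments for the mixture *)

Section mixture_increments.
Context {R : realType} {d : nat}.
Local Notation mu := (@lebesgue_measure R).
Implicit Types u w : 'cV[R]_d.

Definition incr_mixture (nu b : R) p u w : R :=
  \sum_(j < p.+1) \sum_(k < p.+1) diff_coef p j * diff_coef p k *
    mixture nu b (sqn (u + (j%:R - k%:R) *: w) / 4).

Lemma continuous_gauss_incr p u w : continuous (fun r : R => gauss_incr p u w (expR (- r) / 4)).
Proof.
move=> r; apply: cvg_big => [|j _]; first exact: add_continuous.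
apply: cvg_big => [|k _]; first exact: add_continuous.
apply: cvgM; first exact: cvg_cst.
apply: continuous_comp; last exact: continuous_expR.
apply: cvgN; apply: cvgM; last exact: cvg_cst.
apply: cvgM; last exact: cvg_cst.
by apply: continuous_comp; [exact: opp_continuous|exact: continuous_expR].
Qed.

(** Sum and integral are exchanged: the mixture superposes the Gaussian covariances with s = e^(-r)
    / 4. *)
Lemma incr_mixtureE (nu b : R) p u w : 0 < nu -> 0 < b ->
  incr_mixture nu b p u w =
  \int[mu]_r (expR (nu * r - b * expR r) * gauss_incr p u w (expR (- r) / 4)).
Proof.
move=> nu0 b0; pose c (jk : 'I_p.+1 * 'I_p.+1) : R := diff_coef p jk.1 * diff_coef p jk.2.
pose Q (jk : 'I_p.+1 * 'I_p.+1) : R := sqn (u + (jk.1%:R - jk.2%:R) *: w) / 4.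
have Q0 jk : 0 <= Q jk by rewrite divr_ge0 ?sqn_ge0.
rewrite /incr_mixture pair_big /=.
have [_ <-] := @Rintegral_lincomb _ _ R mu _ (index_enum _) c (fun jk => mix_kernel nu b (Q jk))
   (fun jk => integrable_mix_kernel nu b (Q jk) nu0 b0 (Q0 jk)).
apply: eq_Rintegral => r _; rewrite /gauss_incr pair_big mulr_sumr; apply: eq_bigr => jk _ /=.
rewrite mulrCA; congr (_ * _); rewrite -expRD; congr expR; rewrite /Q; ring.
Qed.

(** On a single segment the arguments are (j - k)^2 |w|^2, so the change of scale |w|^2 leaves only
    |w|^(2 nu) and the parameter b |w|^2. *)
Lemma incr_mixture0 (nu b : R) p w : w != 0 ->
  incr_mixture nu b p 0 w = sqn w `^ nu *
  \sum_(j < p.+1) \sum_(k < p.+1) diff_coef p j * diff_coef p k *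
    mixture nu (b * sqn w) ((j%:R - k%:R) ^+ 2 / 4).
Proof.
move=> w0; rewrite /incr_mixture mulr_sumr; apply: eq_bigr => j _.
rewrite mulr_sumr; apply: eq_bigr => k _.
have W0 := sqn_gt0 _ w0.
rewrite add0r sqnZ (mixture_shift _ _ _ _ W0) mulrCA; congr (_ * (_ * mixture _ _ _)).
by field; rewrite gt_eqF.
Qed.

(** Integrates [gauss_incr_grid] over r. As exp(- b e^r) <= 1, C does not depend on b, hence later
    not on the mesh. *)
Lemma incr_mixture_grid (nu c : R) (q : nat) (M : 'M[R]_d) (e : 'cV[R]_d) (L : R) :
  0 < nu -> M *m e != 0 -> 0 <= c -> 2 * nu + 1 + d%:R <= q%:R ->
  (forall (z w : 'I_d -> nat) j k, (j <= 4 * q)%N -> (k <= 4 * q)%N ->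
    c * \sum_i ((z i)%:R - (w i)%:R) ^+ 2 <=
    sqn (M *m (grid_vec L z - grid_vec L w) + (j%:R - k%:R) *: (M *m e))) ->
  exists2 C : R, 0 <= C & forall (b : R) (z w : 'I_d -> nat), 0 < b ->
    `|incr_mixture nu b (4 * q)%N (M *m (grid_vec L z - grid_vec L w)) (M *m e)| <=
    C * \prod_(i < d) decay (c / 8) ((z i)%:R - (w i)%:R).
Proof.
move=> nu0 e0 c0 hq hm; have [C C0 hC] := gauss_incr_grid _ _ _ _ _ _ nu0 e0 c0 hq hm.
pose I := \int[mu]_r expR (- (nu * `|r|)).
exists (C * I) => [|b z w b0].
  by rewrite mulr_ge0//; apply: Rintegral_ge0 => r _; exact: expR_ge0.
rewrite incr_mixtureE// mulrAC.
set P := \prod_(i < d) _; have Ii := integrable_expRN_norm nu nu0.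
rewrite /I -RintegralZl//.
apply: (Rintegral_norm_le _ _ _ _ _ _).2.
- apply: continuous_measurable_fun => r; apply: cvgM; last exact: continuous_gauss_incr.
  apply: continuous_comp; last exact: continuous_expR.
  apply: cvgB; first by apply: cvgM; [exact: cvg_cst|exact: cvg_id].
  by apply: cvgM; [exact: cvg_cst|exact: continuous_expR].
- have := integrableZl measurableT (C * P) Ii; exact.
- move=> r; rewrite normrM (ger0_norm (expR_ge0 _)).
  apply: le_trans (hC z w r); rewrite ler_wpM2r//.
  apply: (@le_trans _ _ (expR (nu * r))); first by rewrite ler_expR gerBl mulr_ge0 ?expR_ge0// ltW.
  by rewrite ler_peMr ?expR_ge0// lerDl expR_ge0.
Qed.
End mixture_increments.

(** * The variance of one increment as a function of b *)

Section gram_mixture.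
Context {R : realType}.
Local Notation mu := (@lebesgue_measure R).

(** The function G in the mean of the statistic. *)
Definition gram_mixture (nu : R) p (b : R) : R :=
  \sum_(j < p.+1) \sum_(k < p.+1) diff_coef p j * diff_coef p k *
    mixture nu b ((j%:R - k%:R) ^+ 2 / 4).

(** A unit vector in dimension 1, through which the bounds on [gauss_incr] apply to scalar
    differences. *)
Let one : 'cV[R]_1 := const_mx 1.

Let sqn_one x : sqn (x *: one) = x ^+ 2.
Proof. by rewrite /sqn big_ord1 !mxE mulr1. Qed.

Let g p r := gauss_incr p 0 one (expR (- r) / 4).

Let gE p r : g p r = gram p.+1 (fun j : 'I_p.+1 => diff_coef p j) (expR (- r) / 4).
Proof.
by apply: eq_bigr => j _; apply: eq_bigr => k _; rewrite add0r sqn_one.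
Qed.

Let g_ge0 p r : 0 <= g p r.
Proof. by rewrite gE; apply: gram_ge0; rewrite divr_ge0// expR_ge0. Qed.

(** As r tends to minus infinity, s tends to infinity and [gram_lim] applies; the coefficient of
    index 0 is 1, so the squares sum to at least 1. *)
Let g_gt0 p : exists r0, forall r, r <= r0 -> 2^-1 <= g p r.
Proof.
have [s0 hs] := @gram_lim R p.+1 (fun j => diff_coef p j).
exists (- ln (4 * (`|s0| + 1))) => r hr.
rewrite gE; apply: le_trans (hs _ _).
  rewrite big_ord_recl /= /diff_coef expr0 bin0 mul1r expr1n lerBrDr.
  rewrite (_ : 2^-1 + 2^-1 = 1); last by field.
  by rewrite lerDl sumr_ge0// => i _; exact: sqr_ge0.
rewrite ler_pdivlMr// mulrC.
have h4 : 0 < 4 * (`|s0| + 1) by rewrite mulr_gt0// ltr_wpDl.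
apply: (@le_trans _ _ (4 * (`|s0| + 1))).
  by rewrite ler_wpM2l// (le_trans (ler_norm _))// lerDl.
by rewrite -[leLHS]lnK ?posrE// ler_expR lerNr.
Qed.

Let continuous_g p : continuous (g p).
Proof. exact: continuous_gauss_incr. Qed.

(** The case of a single grid point in dimension 1, with c = 0. *)
Let g_le (nu : R) (q : nat) : 0 < nu -> 2 * nu + 2 <= q%:R ->
  exists2 C : R, 0 <= C & forall r, expR (nu * r) * (1 + expR r) * g (4 * q)%N r <=
    C * expR (- (nu * `|r|)).
Proof.
move=> nu0 hq; have one0 : (1%:M : 'M[R]_1) *m one != 0.
  by rewrite mul1mx; apply/eqP => /matrixP/(_ 0 0)/eqP; rewrite !mxE oner_eq0.
have [||C C0 hC] := @gauss_incr_grid R 1 nu 0 q 1%:M one 0 nu0 one0 (lexx _).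
- by rewrite -addrA (_ : 1 + 1 = 2).
- by move=> z w j k _ _; rewrite mul0r sqn_ge0.
exists C => // r; have := hC (fun=> 0%N) (fun=> 0%N) r.
rewrite subrr mulmx0 mul1mx -/(g _ r) (ger0_norm (g_ge0 _ _)).
rewrite big1 ?mulr1// => i _.
by rewrite /decay !mul0r addr0 invr1.
Qed.

(** G(b) is the integral of exp(nu r - b e^r) against the nonnegative [g], and G0 is that integral
    at b = 0. From 1 - b e^r <= exp(- b e^r) comes C; from exp(x) >= 1 + x comes the slope c, the
    integral of e^r exp(nu r - e^r) against [g], the worst case b2 = 1. *)
Lemma gram_mixture_spec (nu : R) (q : nat) : 0 < nu -> 2 * nu + 2 <= q%:R ->
  exists G0 C c : R, [/\ 0 < G0, 0 <= C, 0 < c,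
    (forall b, 0 < b -> G0 - C * b <= gram_mixture nu (4 * q)%N b <= G0) &
    (forall b1 b2, 0 < b1 -> b1 < b2 -> b2 <= 1 ->
      c * (b2 - b1) <= gram_mixture nu (4 * q)%N b1 - gram_mixture nu (4 * q)%N b2)].
Proof.
move=> nu0 hq; have [C C0 hC] := g_le _ _ nu0 hq.
set p := (4 * q)%N in hC *.
have GE b : 0 < b -> gram_mixture nu p b = \int[mu]_r (expR (nu * r - b * expR r) * g p r).
  move=> b0; rewrite -incr_mixtureE//; apply: eq_bigr => j _; apply: eq_bigr => k _.
  by rewrite add0r sqn_one.
have int (f : R -> R) : continuous f ->
    (forall r, 0 <= f r <= expR (nu * r) * (1 + expR r)) ->
    mu.-integrable setT (EFin \o (fun r => f r * g p r)).
  move=> cf hf.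
  apply: (@Rintegral_norm_le _ _ R mu (fun r => f r * g p r) (fun r : R => C * expR (- (nu * `|r|))) _ _ _).1.
  - by apply: continuous_measurable_fun => r; apply: cvgM; [exact: cf|exact: continuous_g].
  - by have := integrableZl measurableT C (integrable_expRN_norm nu nu0); exact.
  - move=> r; have /andP[f0 f1] := hf r; apply: le_trans (hC r).
    by rewrite ger0_norm ?mulr_ge0// ler_wpM2r.
have cnu (a : R) : continuous (fun r : R => expR (a * r)).
  move=> r; apply: continuous_comp; last exact: continuous_expR.
  by apply: cvgM; [exact: cvg_cst|exact: cvg_id].
have cb (b : R) : continuous (fun r : R => expR (nu * r - b * expR r)).
  move=> r; apply: continuous_comp; last exact: continuous_expR.
  apply: cvgB; first by apply: cvgM; [exact: cvg_cst|exact: cvg_id].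
  by apply: cvgM; [exact: cvg_cst|exact: continuous_expR].
have I0 : mu.-integrable setT (EFin \o (fun r => expR (nu * r) * g p r)).
  apply: int => // r; rewrite expR_ge0 ler_peMr ?expR_ge0// lerDl expR_ge0//.
have I1 : mu.-integrable setT (EFin \o (fun r => expR (nu * r) * expR r * g p r)).
  apply: int => [r|r]; first by apply: cvgM; [exact: cnu|exact: continuous_expR].
  by rewrite mulr_ge0 ?expR_ge0//= ler_wpM2l ?expR_ge0// lerDr.
have le1 b r : 0 < b -> expR (nu * r - b * expR r) <= expR (nu * r).
  by move=> b0; rewrite ler_expR gerBl mulr_ge0 ?expR_ge0// ltW.
have Ib b : 0 < b -> mu.-integrable setT (EFin \o (fun r => expR (nu * r - b * expR r) * g p r)).
  move=> b0; apply: int => // r; rewrite expR_ge0 (le_trans (le1 b r b0))//.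
  by rewrite ler_peMr ?expR_ge0// lerDl expR_ge0.
have I2 : mu.-integrable setT (EFin \o (fun r => expR (nu * r - 1 * expR r) * expR r * g p r)).
  apply: int => [r|r]; first by apply: cvgM; [exact: cb|exact: continuous_expR].
  rewrite mulr_ge0 ?expR_ge0//=; apply: ler_pM; rewrite ?expR_ge0 ?le1//.
  by rewrite lerDr.
have [r0 hr0] := g_gt0 p.
exists (\int[mu]_r (expR (nu * r) * g p r)), (\int[mu]_r (expR (nu * r) * expR r * g p r)),
  (\int[mu]_r (expR (nu * r - 1 * expR r) * expR r * g p r)); split.
- apply: (Rintegral_gt0 _ _ (r0 - 1) (expR (nu * (r0 - 1)) * 2^-1)) => //.
  + by move=> r; rewrite mulr_ge0 ?expR_ge0.
  + by rewrite mulr_gt0 ?expR_gt0.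
  + move=> r; rewrite subrK => /andP[ra rb].
    by rewrite ler_pM ?expR_ge0 ?hr0// ler_expR ler_wpM2l// ltW.
- by apply: Rintegral_ge0 => r _; rewrite !mulr_ge0 ?expR_ge0.
- apply: (Rintegral_gt0 _ _ (r0 - 1) (expR (nu * (r0 - 1) - 1 * expR r0) * expR (r0 - 1) * 2^-1)) => //.
  + by move=> r; rewrite !mulr_ge0 ?expR_ge0.
  + by rewrite !mulr_gt0 ?expR_gt0.
  + move=> r; rewrite subrK => /andP[ra rb].
    rewrite ler_pM ?hr0 ?mulr_ge0 ?expR_ge0// ler_pM ?expR_ge0 ?ler_expR//.
    by rewrite lerB// ?mul1r ?ler_expR// ler_wpM2l// ltW.
- move=> b b0; rewrite GE//; apply/andP; split; last first.
    apply: le_Rintegral => //; first exact: Ib.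
    by move=> r _; rewrite ler_wpM2r ?le1.
  rewrite mulrC -RintegralZl// -RintegralB//; last first.
    by have := integrableZl measurableT b I1; exact.
  apply: le_Rintegral => //.
  + have := integrableB measurableT I0 (integrableZl measurableT b I1); exact.
  + exact: Ib.
  + move=> r _ /=; rewrite mulrA -mulrBl ler_wpM2r// expRD.
    rewrite (_ : _ - _ = expR (nu * r) * (1 + - (b * expR r))); last by ring.
    by rewrite ler_wpM2l ?expR_ge0// expR_ge1Dx.
- move=> b1 b2 b10 b12 b21; have b20 := lt_trans b10 b12.
  rewrite !GE// -RintegralB//; [|exact: Ib..].
  rewrite mulrC -RintegralZl//; apply: le_Rintegral => //.
  + by have := integrableZl measurableT (b2 - b1) I2; exact.
  + by have := integrableB measurableT (Ib b1 b10) (Ib b2 b20); exact.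
  + move=> r _ /=; rewrite mulrA -mulrBl ler_wpM2r//.
    rewrite (_ : nu * r - b1 * expR r = (nu * r - b2 * expR r) + (b2 - b1) * expR r); last by ring.
    set A := nu * r - b2 * expR r.
    rewrite [X in _ <= X](_ : _ = expR A * (expR ((b2 - b1) * expR r) - 1)); last first.
      by rewrite expRD; ring.
    rewrite mulrC -mulrA.
    apply: ler_pM; rewrite ?expR_ge0 ?mulr_ge0 ?expR_ge0 ?subr_ge0 ?(ltW b12)//.
      by rewrite ler_expR lerB// ler_wpM2r ?expR_ge0.
    by rewrite lerBrDr addrC [expR r * _]mulrC expR_ge1Dx.
Qed.
End gram_mixture.

(** * Moments of Gaussian variables *)

Section normal_integral.
Context {R : realType}.
Local Notation mu := (@lebesgue_measure R).

(** The fundamental theorem of calculus on [-n, n], then dominated convergence; it replaces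
    integration by parts below. *)
Lemma Rintegral_derive0 (F f : R -> R) :
  (forall x, is_derive x (1 : R) F (f x)) -> continuous f ->
  mu.-integrable setT (EFin \o f) ->
  F n%:R @[n --> \oo] --> 0 -> F (- n%:R) @[n --> \oo] --> 0 ->
  \int[mu]_x f x = 0.
Proof.
move=> dF cf fi F1 F2; pose I n : set R := `[- n%:R, n%:R]%classic.
pose f_ n : R -> \bar R := (EFin \o f) \_ (I n).
have mf : measurable_fun setT f by exact: continuous_measurable_fun.
have mI n : measurable (I n) by exact: measurable_itv.
have [] := @dominated_convergence _ _ _ mu setT measurableT f_ (EFin \o f) (fun x => `|f x|%:E).
- move=> n; apply/(measurable_restrictT (EFin \o f)); first exact: mI.
  by apply/measurable_EFinP; exact: measurable_funTS.
- exact/measurable_EFinP.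
- apply: aeW => x _; apply: cvg_near_cst.
  exists (Num.truncn `|x|).+1 => // n /= hn.
  rewrite /f_ patchE mem_set// /I /= in_itv/= -ler_norml.
  by rewrite (le_trans (ltW (truncnS_gt _)))// ler_nat.
- by have := integrable_norm fi; exact.
- apply: aeW => x n _; rewrite /f_ /= patchE; case: ifP => _ //=.
  by rewrite normr0 lee_fin.
move=> _ _ cv.
have E n : (\int[mu]_x f_ n.+1 x = (F n.+1%:R - F (- n.+1%:R))%:E)%E.
  rewrite /f_ -integral_mkcond /= (@continuous_FTC2 _ f F)//.
  - by rewrite -subr_gt0 opprK -natrD ltr0n.
  - exact: continuous_subspaceT.
  - have cF x : {for x, continuous F}.
      by apply/differentiable_continuous/derivable1_diffP; exact: (@ex_derive _ _ _ _ _ _ _ (dF x)).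
    split.
    + by move=> x _; exact: (@ex_derive _ _ _ _ _ _ _ (dF x)).
    + by apply: cvg_at_right_filter; exact: cF.
    + by apply: cvg_at_left_filter; exact: cF.
  - by move=> x _; rewrite derive1E derive_val.
rewrite /Rintegral; suff -> : (\int[mu]_x (f x)%:E = 0)%E by [].
move: cv; rewrite -cvg_shiftS /= (funext E) => cv.
apply: (cvg_unique _ cv) => //.
rewrite -[0%E]/((0 : R)%:E) -(subr0 (0 : R)); apply/cvg_EFin; first exact: nearW.
apply: cvgB.
- by move: F1; rewrite -cvg_shiftS.
- by move: F2; rewrite -cvg_shiftS.
Qed.

Section moments.
Variables (m s : R) (s0 : 0 < s).
Let phi := normal_pdf m s.

Let phiE x : phi x = normal_peak s * expR (- (x - m) ^+ 2 / (s ^+ 2 *+ 2)).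
Proof. by rewrite /phi normal_pdfE// gt_eqF. Qed.

(** With t = (x - m) / (2 s) the Gaussian factor is exp(- t^2) twice: one copy absorbs the power,
    the other yields the exponential through |x| / s <= |m| / s + 2 |t| and 2 |t| <= 1 + t^2. *)
Let phi_tail k : exists2 C : R, 0 <= C &
  forall x, `|(x - m) ^+ k * phi x| <= C * expR (- (s^-1 * `|x|)).
Proof.
pose K := (2 * s) ^+ k * (1 + k`!%:R) * expR 1 * expR (s^-1 * `|m|).
have K0 : 0 <= K by rewrite !mulr_ge0 ?expR_ge0 ?exprn_ge0 ?mulr_ge0// ltW.
exists (normal_peak s * K) => [|x]; first by rewrite mulr_ge0 ?normal_peak_ge0.
pose t := (x - m) / (2 * s).
have s0' : s != 0 by rewrite gt_eqF.
have xt : x - m = 2 * s * t by rewrite /t; field.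
rewrite phiE mulrCA normrM (ger0_norm (normal_peak_ge0 _)) -mulrA ler_wpM2l ?normal_peak_ge0//.
rewrite (_ : - (x - m) ^+ 2 / (s ^+ 2 *+ 2) = - t ^+ 2 + - t ^+ 2); last first.
  by rewrite xt -mulr_natr; field.
rewrite expRD mulrA normrM (ger0_norm (expR_ge0 _)).
apply: (@le_trans _ _ ((2 * s) ^+ k * (1 + k`!%:R) * expR (- t ^+ 2))).
  rewrite ler_wpM2r ?expR_ge0// xt normrM normrX normrM (ger0_norm (expR_ge0 _)) exprMn -mulrA.
  rewrite (@ger0_norm _ (2 * s)) ?mulr_ge0 ?(ltW s0)// ler_wpM2l ?exprn_ge0 ?mulr_ge0 ?(ltW s0)//.
  exact: expr_gauss_le.
rewrite /K -!mulrA; do 2 (rewrite ler_wpM2l ?exprn_ge0 ?mulr_ge0 ?addr_ge0 ?(ltW s0)//).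
rewrite -!expRD ler_expR.
have h1 : `|x| <= `|m| + 2 * s * `|t|.
  rewrite -[in leLHS](subrK m x) addrC (le_trans (ler_normD _ _))// lerD2l xt normrM.
  by rewrite (@ger0_norm _ (2 * s)) ?mulr_ge0 ?(ltW s0).
have h2 : s^-1 * `|x| <= s^-1 * `|m| + 2 * `|t|.
  rewrite (_ : 2 * `|t| = s^-1 * (2 * s * `|t|)); last by field.
  by rewrite -mulrDr ler_wpM2l// invr_ge0 ltW.
have h3 : 2 * `|t| <= 1 + t ^+ 2.
  have := sqr_ge0 (`|t| - 1); rewrite sqrrB expr1n mulr1 real_normK ?num_real// -mulr_natl.
  lra.
lra.
Qed.

Let continuous_phik k : continuous (fun x => (x - m) ^+ k * phi x).
Proof.
move=> x; apply: cvgM; last by apply: continuous_normal_pdf; rewrite gt_eqF.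
apply: (cvg_comp (fun x => x - m) (fun y => y ^+ k)); last exact: exprn_continuous.
by apply: cvgB; [exact: cvg_id|exact: cvg_cst].
Qed.

Lemma integrable_normal_moment k : mu.-integrable setT (EFin \o (fun x => (x - m) ^+ k * phi x)).
Proof.
have [C C0 hC] := phi_tail k.
apply: (@Rintegral_norm_le _ _ R mu _ (fun x : R => C * expR (- (s^-1 * `|x|))) _ _ hC).1.
  by apply: continuous_measurable_fun; exact: continuous_phik.
have := integrableZl measurableT C (integrable_expRN_norm s^-1 _); apply.
by rewrite invr_gt0.
Qed.

Let cvg_phik k (u : nat -> R) : (forall n, `|u n| = n%:R) ->
  (u n - m) ^+ k * phi (u n) @[n --> \oo] --> 0.
Proof.
move=> hu; have [C C0 hC] := phi_tail k.
apply/norm_cvg0P.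
apply: (squeeze_cvgr (f := cst 0) (h := fun n => C * expR (- s^-1) ^+ n)).
- apply: nearW => n; rewrite normr_ge0/=; apply: le_trans (hC (u n)) _.
  by rewrite hu -expRM_natr mulNr.
- exact: cvg_cst.
- rewrite -(mulr0 C); apply: cvgM; first exact: cvg_cst.
  by apply: cvg_expr; rewrite ger0_norm ?expR_ge0// expR_lt1 oppr_lt0 invr_gt0.
Qed.

Let dphi (x : R) : is_derive x (1 : R) phi (- (x - m) / s ^+ 2 * phi x).
Proof.
have s0' : s != 0 by rewrite gt_eqF.
have dl : is_derive x (1 : R) (fun x => - (x - m) ^+ 2 / (s ^+ 2 *+ 2)) (- (x - m) / s ^+ 2).
  apply: is_derive_eq; rewrite /GRing.scale/= -mulr_natr; field.
  exact: s0'.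
have phif : phi = fun x => normal_peak s * expR (- (x - m) ^+ 2 / (s ^+ 2 *+ 2)) := funext phiE.
rewrite phif.
have dZ := is_deriveZ (normal_peak s) (@is_derive1_comp R expR _ x _ _ (is_derive_expR _) dl).
rewrite (_ : _ * (_ * _) = normal_peak s *: (expR (- (x - m) ^+ 2 / (s ^+ 2 *+ 2)) * (- (x - m) / s ^+ 2))).
  exact: dZ.
by rewrite /GRing.scale/=; ring.
Qed.

(** The derivative of (x - m)^(k + 1) [phi] has integral 0. *)
Lemma normal_momentS k :
  \int[mu]_x ((x - m) ^+ k.+2 * phi x) = s ^+ 2 * (k.+1%:R * \int[mu]_x ((x - m) ^+ k * phi x)).
Proof.
have s0' : s != 0 by rewrite gt_eqF.
have I0 := integrable_normal_moment k; have I2 := integrable_normal_moment k.+2.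
have J0 := integrableZl measurableT k.+1%:R I0; have J2 := integrableZl measurableT (s ^- 2) I2.
have : \int[mu]_x (k.+1%:R * ((x - m) ^+ k * phi x) - s ^- 2 * ((x - m) ^+ k.+2 * phi x)) = 0.
  apply: (@Rintegral_derive0 (fun x => (x - m) ^+ k.+1 * phi x)).
  - move=> x.
    have dX : is_derive x (1 : R) (fun x => (x - m) ^+ k.+1) (k.+1%:R * (x - m) ^+ k).
      have dX0 : is_derive x (1 : R) (fun x => x - m) 1 by apply: is_derive_eq; rewrite subr0.
      have dX1 := is_deriveX k.+1 dX0.
      rewrite (_ : (fun x => _) = (fun x => x - m) ^+ k.+1); last first.
        by apply/funext => y; rewrite exprfctE.
      by rewrite -[X in is_derive _ _ _ X]mulr1; exact: dX1.
    have dM := is_deriveM dX (dphi x).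
    rewrite (_ : k.+1%:R * _ - _ = (x - m) ^+ k.+1 *: (- (x - m) / s ^+ 2 * phi x) +
       phi x *: (k.+1%:R * (x - m) ^+ k)); first exact: dM.
    by rewrite /GRing.scale/= !exprS; field.
  - move=> x; apply: cvgB; (apply: cvgM; [exact: cvg_cst|exact: continuous_phik]).
  - by have := integrableB measurableT J0 J2; exact.
  - by apply: cvg_phik => n; rewrite normr_nat.
  - by apply: cvg_phik => n; rewrite normrN normr_nat.
rewrite RintegralB// !RintegralZl//.
move/eqP; rewrite subr_eq0 => /eqP ->.
by rewrite mulrA mulfV ?mul1r// expf_neq0// gt_eqF.
Qed.

Lemma normal_moment0 : \int[mu]_x ((x - m) ^+ 0 * phi x) = 1.
Proof.
under eq_Rintegral do rewrite expr0 mul1r.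
by rewrite /Rintegral integral_normal_pdf.
Qed.

Lemma normal_moment1 : \int[mu]_x ((x - m) ^+ 1 * phi x) = 0.
Proof.
have s0' : s != 0 by rewrite gt_eqF.
have I1 := integrable_normal_moment 1.
(* The integrand is the derivative of [phi] itself. *)
have : \int[mu]_x (- s ^- 2 * ((x - m) ^+ 1 * phi x)) = 0.
  apply: (@Rintegral_derive0 phi).
  - move=> x; rewrite (_ : _ * _ = - (x - m) / s ^+ 2 * phi x); first exact: dphi.
    by rewrite expr1; field.
  - by move=> x; apply: cvgM; [exact: cvg_cst|exact: continuous_phik].
  - by have := integrableZl measurableT (- s ^- 2) I1; exact.
  - have := @cvg_phik 0 (fun n => n%:R) (fun n => normr_nat _ n).
    by under eq_cvg do rewrite expr0 mul1r.
  - have := @cvg_phik 0 (fun n => - n%:R) (fun n => etrans (normrN _) (normr_nat _ n)).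
    by under eq_cvg do rewrite expr0 mul1r.
rewrite RintegralZl// => /eqP; rewrite mulf_eq0 oppr_eq0 invr_eq0 expf_eq0 (negbTE s0') andbF /=.
by move/eqP.
Qed.

Lemma normal_moment2 : \int[mu]_x ((x - m) ^+ 2 * phi x) = s ^+ 2.
Proof. by rewrite normal_momentS normal_moment0 !mulr1. Qed.

Lemma normal_moment4 : \int[mu]_x ((x - m) ^+ 4 * phi x) = 3 * s ^+ 4.
Proof. rewrite normal_momentS normal_moment2; ring. Qed.
End moments.

(** The truncations min(f, n) are bounded, hence integrable, so the Radon-Nikodym change of
    variables applies to them; monotone convergence on both sides reaches f. *)
Lemma ge0_integral_normal_prob (m s : R) (f : R -> R) : s != 0 ->
  measurable_fun setT f -> (forall x, 0 <= f x) ->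
  (\int[normal_prob m s]_x (f x)%:E = \int[mu]_x (f x * normal_pdf m s x)%:E)%E.
Proof.
move=> s0 mf f0.
pose f_ n x := Num.min (f x) n%:R.
have mf_ n : measurable_fun setT (f_ n) by exact: measurable_minr.
have mpdf := measurable_normal_pdf m s.
have B n : (\int[normal_prob m s]_x (f_ n x)%:E = \int[mu]_x (f_ n x * normal_pdf m s x)%:E)%E.
  have I : (normal_prob m s).-integrable setT (EFin \o f_ n).
    apply: measurable_bounded_integrable => //; [|exact: mf_|].
      by rewrite (le_lt_trans (probability_le1 _ _))// ltry.
    exists n%:R; split; first exact: num_real.
    move=> y ny x _ /=; rewrite ger0_norm ?le_min ?f0//=.
    by rewrite (le_trans _ (ltW ny))// ge_min lexx orbT.
  rewrite -(Radon_Nikodym_change_of_variables (normal_prob_dominates m s))//.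
  under [RHS]eq_integral do rewrite EFinM.
  have mf'_ : measurable_fun setT (fun x => (f_ n x)%:E).
    by apply/measurable_EFinP; exact: mf_.
  have mp : measurable_fun setT (fun x => (normal_pdf m s x)%:E) by exact/measurable_EFinP.
  apply: ae_eq_integral => //=.
  - apply: emeasurable_funM => //.
    by apply: (measurable_int mu); apply: Radon_Nikodym_integrable; exact: normal_prob_dominates.
  - by apply: emeasurable_funM.
  - apply: ae_eqe_mul2l => /=.
    rewrite Radon_NikodymE//=; first exact: normal_prob_dominates.
    move=> nmu; case: cid => /= h [h1 h2 h3].
    apply: integral_ae_eq => //=.
    by move=> E E01 mE; rewrite -h3.
have cvn (x : R) : f_ n x @[n --> \oo] --> f x.
  apply: cvg_near_cst; exists (Num.truncn (f x)).+1 => // n /= hn.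
  by rewrite /f_ min_l// (le_trans (ltW (truncnS_gt _)))// ler_nat.
have nd (x : R) : {homo (fun n => f_ n x) : k l / (k <= l)%N >-> k <= l}.
  by move=> k l kl; rewrite le_min ge_min lexx/= ge_min ler_nat kl orbT.
have f_0 n x : 0 <= f_ n x by rewrite le_min f0/=.
have E1 : (\int[normal_prob m s]_x (f x)%:E = limn (fun n => \int[normal_prob m s]_x (f_ n x)%:E))%E.
  rewrite -monotone_convergence//.
  - apply: eq_integral => x _; apply/esym/cvg_lim => //.
    by apply: cvg_comp (cvn x) _; exact: cvg_id.
  - by move=> n; apply/measurable_EFinP; exact: mf_.
  - by move=> n x _; rewrite lee_fin.
  - by move=> x _ k l kl; rewrite lee_fin; exact: nd.
have E2 : (\int[mu]_x (f x * normal_pdf m s x)%:E =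
   limn (fun n => \int[mu]_x (f_ n x * normal_pdf m s x)%:E))%E.
  rewrite -monotone_convergence//.
  - apply: eq_integral => x _; apply/esym/cvg_lim => //.
    apply: cvg_near_cst; exists (Num.truncn (f x)).+1 => // n /= hn.
    by rewrite /f_ min_l// (le_trans (ltW (truncnS_gt _)))// ler_nat.
  - by move=> n; apply/measurable_EFinP; apply: measurable_funM => //; exact: mf_.
  - by move=> n x _; rewrite lee_fin mulr_ge0 ?normal_pdf_ge0.
  - by move=> x _ k l kl; rewrite lee_fin ler_wpM2r ?normal_pdf_ge0//; exact: nd.
rewrite E1 E2; congr (limn _); apply/funext => n; exact: B.
Qed.
End normal_integral.

(** * Fourth moments of Gaussian variables and pairs *)

Section gaussian_moments.
Context {disp : measure_display} {T : measurableType disp} {R : realType}.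
Variable P : probability T R.
Local Notation mu := (@lebesgue_measure R).

(* The first moment is replaced by the second moment about m - 1, so that all
   three integrands are nonnegative and no integrability is needed. *)
Lemma gaussian_moments (X : T -> R) : measurable_fun setT X -> is_gaussian (P := P) X ->
  exists m s : R, [/\ (\int[P]_w ((X w - m) ^+ 2)%:E = (s ^+ 2)%:E)%E,
    (\int[P]_w ((X w - m) ^+ 4)%:E = (3 * s ^+ 4)%:E)%E &
    (\int[P]_w ((X w - m + 1) ^+ 2)%:E = (s ^+ 2 + 1)%:E)%E].
Proof.
move=> mX [m [s [s0 law_X]]]; exists m, s.
pose X' : {mfun T >-> measurableTypeR R} :=
  HB.pack X (isMeasurableFun.Build _ _ _ (measurableTypeR R) X mX).
have key (f : R -> R) : measurable_fun setT f -> (forall x, 0 <= f x) ->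
    (\int[P]_w (f (X w))%:E = if (s == 0)%R then (f m)%:E else
      \int[mu]_x (f x * normal_pdf m s x)%:E)%E.
  move=> mf f0; have mf' : measurable_fun (setT : set (measurableTypeR R)) (EFin \o f) by exact/measurable_EFinP.
  rewrite -(@ge0_integral_distribution _ _ _ _ _ P X' (EFin \o f))//.
  have [sE|sN] := eqVneq s 0.
    rewrite (eq_measure_integral (@dirac _ (measurableTypeR R) m R : measure _ R)); last first.
      move=> A mA _; have := law_X A mA; rewrite /normal_law sE eqxx; exact.
    by rewrite integral_dirac//= diracT mul1e.
  rewrite -ge0_integral_normal_prob//.
  apply: eq_measure_integral => A mA _.
  by have := law_X A mA; rewrite /normal_law (negbTE sN); exact.
have mXm : measurable_fun setT (fun x : R => x - m) by exact: measurable_funB.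
have moment k : s != 0 ->
    (\int[mu]_x ((x - m) ^+ k * normal_pdf m s x)%:E =
     (\int[mu]_x ((x - m) ^+ k * normal_pdf m s x))%:E)%E.
  move=> sN; rewrite fineK//; apply: integrable_fin_num => //.
  by apply: integrable_normal_moment; rewrite lt0r sN.
split.
- rewrite (key (fun x => (x - m) ^+ 2)); last 2 first.
  + exact: measurable_funX.
  + by move=> x; exact: sqr_ge0.
  case: eqVneq => [->|sN]; first by rewrite subrr.
  by rewrite moment// normal_moment2// lt0r sN.
- rewrite (key (fun x => (x - m) ^+ 4)); last 2 first.
  + exact: measurable_funX.
  + by move=> x; rewrite exprn_even_ge0.
  case: eqVneq => [->|sN]; first by rewrite subrr !expr0n mulr0.
  by rewrite moment// normal_moment4// lt0r sN.
- rewrite (key (fun x => (x - m + 1) ^+ 2)); last 2 first.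
  + by apply: measurable_funX; exact: measurable_funD.
  + by move=> x; exact: sqr_ge0.
  case: eqVneq => [->|sN]; first by rewrite subrr add0r expr1n expr0n add0r.
  have sP : 0 < s by rewrite lt0r sN.
  have I k := integrable_normal_moment m s sP k.
  pose c (k : nat) : R := if k is 1 then 2 else 1.
  have [J1 J2] := Rintegral_lincomb mu _ [:: 2; 1; 0]%N c _ I.
  move: J2; rewrite !big_cons big_nil /= normal_moment2// normal_moment1// normal_moment0// => J2.
  have sE : (fun x => \sum_(k <- [:: 2; 1; 0]%N) c k * ((x - m) ^+ k * normal_pdf m s x)) =
      (fun x => (x - m + 1) ^+ 2 * normal_pdf m s x).
    by apply/funext => x; rewrite !big_cons big_nil /c; ring.
  rewrite sE in J1 J2.
  transitivity ((\int[mu]_x ((x - m + 1) ^+ 2 * normal_pdf m s x))%:E).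
    by rewrite fineK//; apply: integrable_fin_num.
  rewrite J2 /c; congr EFin; ring.
Qed.

Lemma ge0_integrable (f : T -> R) (c : R) : measurable_fun setT f -> (forall w, 0 <= f w) ->
  (\int[P]_w (f w)%:E = c%:E)%E -> P.-integrable setT (EFin \o f) /\ \int[P]_w f w = c.
Proof.
move=> mf f0 fc; split; last by rewrite /Rintegral fc.
apply/integrableP; split; first exact/measurable_EFinP.
by under eq_integral do rewrite /= ger0_norm//; rewrite fc ltry.
Qed.

(** The parameter m of the law must first be identified with the expectation, hence with 0; the
    moments about m are then the moments of X. *)
Lemma centered_gaussian_moments (X : T -> R) : measurable_fun setT X ->
  is_gaussian (P := P) X -> \int[P]_w X w = 0 ->
  [/\ P.-integrable setT (EFin \o X), P.-integrable setT (EFin \o (fun w => X w ^+ 4)) &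
  \int[P]_w (X w ^+ 4) = 3 * (\int[P]_w (X w ^+ 2)) ^+ 2].
Proof.
move=> mX gX X0; have [m [s [m2 m4 m1]]] := gaussian_moments X mX gX.
have mXm : measurable_fun setT (fun w => X w - m) by exact: measurable_funB.
have mXm1 : measurable_fun setT (fun w => X w - m + 1) by exact: measurable_funD.
have [I2 E2] := ge0_integrable _ _ (measurable_funX 2 mXm) (fun w => sqr_ge0 _) m2.
have [I4 E4] := ge0_integrable (fun w => (X w - m) ^+ 4) _ (measurable_funX 4 mXm)
  (fun w => @exprn_even_ge0 _ 4 _ isT) m4.
have [I1 E1] := ge0_integrable (fun w => (X w - m + 1) ^+ 2) _
  (measurable_funX 2 mXm1) (fun w => sqr_ge0 _) m1.
have Ic : P.-integrable setT (EFin \o (fun=> 1 : R)).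
  by have := finite_measure_integrable_cst P 1 measurableT; exact.
(* X - m = ((X - m + 1)^2 - (X - m)^2 - 1) / 2 is a combination of integrable functions with known
   integrals. *)
have ID : \int[P]_w (X w - m) = 0 /\ P.-integrable setT (EFin \o (fun w => X w - m)).
  pose f (i : nat) w : R := if i is 0 then (X w - m + 1) ^+ 2 else if i is 1 then (X w - m) ^+ 2 else 1.
  pose c (i : nat) : R := if i is 0 then 2^-1 else - 2^-1.
  have fi i : P.-integrable setT (EFin \o f i) by case: i => [|[|i]].
  have [] := Rintegral_lincomb P _ [:: 0; 1; 2]%N c f fi.
  have f0 : \int[P]_w f 0%N w = s ^+ 2 + 1 := E1.
  have f1 : \int[P]_w f 1%N w = s ^+ 2 := E2.
  have f2 : \int[P]_w f 2%N w = 1.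
    by rewrite (@Rintegral_cst _ _ _ _ _ measurableT) [X in fine X]probability_setT mulr1.
  have XE : (fun w => \sum_(i <- [:: 0; 1; 2]%N) c i * f i w) = (fun w => X w - m).
    by apply/funext => w; rewrite !big_cons big_nil /c /f; field.
  rewrite XE !big_cons big_nil f0 f1 f2 => IX ->; split=> //; by rewrite /c; field.
have [E0 I0] := ID.
have m0 : m = 0.
  have := X0; have Ic' := finite_measure_integrable_cst P m measurableT.
  rewrite (_ : X = fun w => (X w - m) + cst m w); last by apply/funext => w; rewrite subrK.
  by rewrite RintegralD// E0 add0r Rintegral_cst// [X in fine X]probability_setT mulr1.
move: I0 I4 E4 E2; rewrite m0.
have sub0 k : (fun w => (X w - 0) ^+ k) = (fun w => X w ^+ k).
  by apply/funext => w; rewrite subr0.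
rewrite !sub0.
rewrite (_ : (fun w => X w - 0) = X); last by apply/funext => w; rewrite subr0.
by move=> IX I4 -> ->; split => //; ring.
Qed.
End gaussian_moments.

Section gaussian_pairs.
Context {disp : measure_display} {T : measurableType disp} {R : realType}.
Variable P : probability T R.
Local Notation E X := (\int[P]_w X w).

Lemma Rintegral_prob_cst (c : R) : E (fun=> c) = c.
Proof. by rewrite (@Rintegral_cst _ _ _ _ _ measurableT) [X in fine X]probability_setT mulr1. Qed.

Lemma integrable_prob_cst (c : R) : P.-integrable setT (EFin \o (fun=> c)).
Proof. exact: finite_measure_integrable_cst. Qed.

Lemma integrable_mulr_sqr (X Y : T -> R) :
  measurable_fun setT X -> measurable_fun setT Y ->
  P.-integrable setT (EFin \o (fun w => X w ^+ 2)) ->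
  P.-integrable setT (EFin \o (fun w => Y w ^+ 2)) ->
  P.-integrable setT (EFin \o (fun w => X w * Y w)).
Proof.
move=> mX mY iX iY.
apply: (Rintegral_norm_le P (fun w => X w * Y w) (fun w => X w ^+ 2 + Y w ^+ 2) _ _ _).1.
- exact: measurable_funM.
- by have := integrableD measurableT iX iY; exact.
- move=> w; have a0 : 0 <= `|X w| by [].
  have b0 : 0 <= `|Y w| by [].
  rewrite normrM -[X w ^+ 2]real_normK ?num_real// -[Y w ^+ 2]real_normK ?num_real//.
  nra.
Qed.

Lemma centered_gaussian_sqr_integrable (X : T -> R) : measurable_fun setT X ->
  is_gaussian (P := P) X -> E X = 0 -> P.-integrable setT (EFin \o (fun w => X w ^+ 2)).
Proof.
move=> mX gX X0; have [_ iX _] := centered_gaussian_moments P X mX gX X0.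
apply: (Rintegral_norm_le P (fun w => X w ^+ 2) (fun w => X w ^+ 4 + 1) _ _ _).1.
- exact: measurable_funX.
- by have := integrableD measurableT iX (integrable_prob_cst 1); exact.
- move=> w; rewrite ger0_norm ?sqr_ge0// (_ : X w ^+ 4 = (X w ^+ 2) ^+ 2) -?exprM//.
  have := sqr_ge0 (X w ^+ 2 - 1); have := sqr_ge0 (X w ^+ 2); nra.
Qed.

(* Polarization: 12 X^2 Y^2 = (X + Y)^4 + (X - Y)^4 - 2 X^4 - 2 Y^4. *)
Lemma centered_gaussian_pair (X Y : T -> R) :
  measurable_fun setT X -> measurable_fun setT Y ->
  (forall a b : R, is_gaussian (P := P) (fun w => a * X w + b * Y w)) ->
  P.-integrable setT (EFin \o X) -> P.-integrable setT (EFin \o Y) ->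
  E X = 0 -> E Y = 0 ->
  P.-integrable setT (EFin \o (fun w => X w ^+ 2 * Y w ^+ 2)) /\
  E (fun w => X w ^+ 2 * Y w ^+ 2) =
    E (fun w => X w ^+ 2) * E (fun w => Y w ^+ 2) + 2 * (E (fun w => X w * Y w)) ^+ 2.
Proof.
move=> mX mY gXY iX iY X0 Y0.
pose Z (a b : R) w := a * X w + b * Y w.
have mZ a b : measurable_fun setT (Z a b).
  by apply: measurable_funD; exact: measurable_funM.
have Z0 a b : E (Z a b) = 0.
  have iaX : P.-integrable setT (EFin \o (fun w => a * X w)).
    by have := integrableZl measurableT a iX; exact.
  have ibY : P.-integrable setT (EFin \o (fun w => b * Y w)).
    by have := integrableZl measurableT b iY; exact.
  by rewrite /Z RintegralD// !RintegralZl// X0 Y0 !mulr0 addr0.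
have M4 a b : P.-integrable setT (EFin \o (fun w => Z a b w ^+ 4)) /\
    E (fun w => Z a b w ^+ 4) = 3 * E (fun w => Z a b w ^+ 2) ^+ 2.
  by have [] := centered_gaussian_moments P (Z a b) (mZ a b) (gXY a b) (Z0 a b).
have ZX : Z 1 0 = X by apply/funext => w; rewrite /Z; ring.
have ZY : Z 0 1 = Y by apply/funext => w; rewrite /Z; ring.
have iX2 : P.-integrable setT (EFin \o (fun w => X w ^+ 2)).
  by apply: centered_gaussian_sqr_integrable => //; have := gXY 1 0; rewrite -/(Z 1 0) ZX.
have iY2 : P.-integrable setT (EFin \o (fun w => Y w ^+ 2)).
  by apply: centered_gaussian_sqr_integrable => //; have := gXY 0 1; rewrite -/(Z 0 1) ZY.
have iXY := integrable_mulr_sqr X Y mX mY iX2 iY2.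
set A := E (fun w => X w ^+ 2); set B := E (fun w => Y w ^+ 2); set c := E (fun w => X w * Y w).
have Z2 a b : E (fun w => Z a b w ^+ 2) = a ^+ 2 * A + 2 * a * b * c + b ^+ 2 * B.
  pose f (i : nat) w := if i is 0 then X w ^+ 2 else if i is 1 then X w * Y w else Y w ^+ 2.
  pose k (i : nat) := if i is 0 then a ^+ 2 else if i is 1 then 2 * a * b else b ^+ 2.
  have fi i : P.-integrable setT (EFin \o f i) by case: i => [|[|i]].
  have [_] := Rintegral_lincomb P _ [:: 0; 1; 2]%N k f fi.
  rewrite (_ : (fun w => \sum_(i <- _) k i * f i w) = (fun w => Z a b w ^+ 2)).
    by move=> ->; rewrite !big_cons big_nil /k /f -/A -/B -/c; ring.
  by apply/funext => w; rewrite !big_cons big_nil /k /f /Z; ring.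
(* The indices 0, 1, 2, 3 stand for X + Y, X - Y, X and Y. *)
pose pa (i : nat) : R := if i is 3 then 0 else 1.
pose pb (i : nat) : R := if i is 1 then -1 else if i is 2 then 0 else 1.
pose k (i : nat) : R := if i is 0 then 12^-1 else if i is 1 then 12^-1 else - 6^-1.
have [] := Rintegral_lincomb P _ [:: 0; 1; 2; 3]%N k (fun i w => Z (pa i) (pb i) w ^+ 4)
  (fun i => (M4 (pa i) (pb i)).1).
rewrite (_ : (fun w => \sum_(i <- _) k i * Z (pa i) (pb i) w ^+ 4) = (fun w => X w ^+ 2 * Y w ^+ 2)).
  move=> I4 ->; split => //; rewrite !big_cons big_nil !(M4 _ _).2 !Z2 /k /pa /pb; by field.
by apply/funext => w; rewrite !big_cons big_nil /k /pa /pb /Z; field.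
Qed.

Section quadratic_statistic.
Variables (I : finType) (X : I -> T -> R).
Hypothesis mX : forall i, measurable_fun setT (X i).
Hypothesis gX : forall i j (a b : R), is_gaussian (P := P) (fun w => a * X i w + b * X j w).
Hypothesis iX : forall i, P.-integrable setT (EFin \o X i).
Hypothesis X0 : forall i, E (X i) = 0.

Let C i j := E (fun w => X i w * X j w).

(** By [centered_gaussian_pair] the squares of X_i and X_j have covariance 2 C_ij^2, so the double
    sum is the variance of the statistic; Markov's inequality is applied to the squared
    deviation. *)
Lemma quadratic_statistic_chebyshev (delta : R) : 0 < delta ->
  (P [set w | (delta <= `|\sum_i X i w ^+ 2 - \sum_i C i i|)%R] <=
   (delta ^- 2 * (2 * \sum_i \sum_j C i j ^+ 2))%:E)%E.
Proof.
move=> d0.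
have pair i j := centered_gaussian_pair (X i) (X j) (mX i) (mX j) (gX i j) (iX i) (iX j) (X0 i) (X0 j).
have CE i : C i i = E (fun w => X i w ^+ 2).
  by congr (Rintegral _ _ _); apply/funext => w; rewrite expr2.
have iX2 i : P.-integrable setT (EFin \o (fun w => X i w ^+ 2)).
  apply: centered_gaussian_sqr_integrable => //; have := gX i i 1 0.
  by rewrite (_ : (fun w => _) = X i)//; apply/funext => w; ring.
pose f (ij : I * I) w := (X ij.1 w ^+ 2 - C ij.1 ij.1) * (X ij.2 w ^+ 2 - C ij.2 ij.2).
have fE ij : P.-integrable setT (EFin \o f ij) /\ E (f ij) = 2 * C ij.1 ij.2 ^+ 2.
  case: ij => i j; have [I4 E4] := pair i j.
  pose g (k : nat) w := if k is 0 then X i w ^+ 2 * X j w ^+ 2 else if k is 1 then X i w ^+ 2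
    else if k is 2 then X j w ^+ 2 else 1.
  pose a (k : nat) := if k is 0 then 1 else if k is 1 then - C j j
    else if k is 2 then - C i i else C i i * C j j.
  have gi k : P.-integrable setT (EFin \o g k).
    by case: k => [|[|[|k]]]; [exact: I4|exact: iX2|exact: iX2|exact: (integrable_prob_cst 1)].
  have [] := Rintegral_lincomb P _ [:: 0; 1; 2; 3]%N a g gi.
  rewrite (_ : (fun w => \sum_(k <- _) a k * g k w) = f (i, j)).
    move=> If ->; split => //; rewrite !big_cons big_nil.
    have e0 : E (g 0%N) = C i i * C j j + 2 * C i j ^+ 2 by rewrite !CE; exact: E4.
    have e1 : E (g 1%N) = C i i by rewrite CE.
    have e2 : E (g 2%N) = C j j by rewrite CE.
    have e3 : E (g 3%N) = 1 := Rintegral_prob_cst 1.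
    rewrite e0 e1 e2 e3 /a /=; ring.
  by apply/funext => w; rewrite !big_cons big_nil /a /g /f /=; ring.
pose D w := \sum_i (X i w ^+ 2 - C i i).
have mD : measurable_fun setT D.
  by apply: measurable_sum => i; apply: measurable_funB => //; exact: measurable_funX.
have [] := Rintegral_lincomb P _ (index_enum (I * I)%type) (fun=> 1) f (fun ij => (fE ij).1).
rewrite (_ : (fun w => \sum_ij 1 * f ij w) = (fun w => D w ^+ 2)); last first.
  apply/funext => w; rewrite expr2 big_distrlr /= pair_big /=.
  by apply: eq_bigr => ij _; rewrite mul1r.
rewrite (eq_bigr (fun ij => 2 * C ij.1 ij.2 ^+ 2)) => [|ij _]; last by rewrite mul1r (fE ij).2.
move=> ID ED.
pose D' : {RV P >-> R} := HB.pack D (isMeasurableFun.Build _ _ _ _ D mD).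
have := @markov _ _ _ P D' (fun x => x ^+ 2) delta d0.
have -> : ('E_P[(fun x : R => x ^+ 2)%R \o (fun x => `|x|)%R \o D'])%E = (\int[P]_w (D w ^+ 2))%:E.
  rewrite unlock fineK; last exact: integrable_fin_num.
  by apply: eq_integral => w _; rewrite /= real_normK ?num_real.
rewrite ED -mulr_sumr => M.
rewrite pair_big /= EFinM lee_pdivlMl ?exprn_gt0//.
rewrite (_ : [set w | _] = [set w | (delta%:E <= `|(D' w)%:E|)%E]).
  apply: M; [exact: measurable_funX|by move=> r r0; rewrite exprn_ge0|].
  by move=> x y; rewrite !nnegrE => x0 y0 xy; rewrite lerXn2r.
by apply/seteqP; split => w /=; rewrite /D' /= lee_fin /D sumrB.
Qed.
End quadratic_statistic.
End gaussian_pairs.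

(** * A criterion for mutual singularity *)

(** Take sets A_k for the summable errors 2^(-(k+1)). By Borel-Cantelli the upper limit of the A_k
    is [mu1]-null; its complement lies in the upper limit of the complements, which is
    [mu2]-null. *)
Lemma mutually_singular_approx (d : measure_display) (T : measurableType d) (R : realType)
    (mu1 mu2 : probability T R) :
  (forall e : R, 0 < e -> exists A : set T, [/\ measurable A, (mu1 A <= e%:E)%E & (mu2 (~` A) <= e%:E)%E]) ->
  mutually_singular mu1 mu2.
Proof.
move=> H; pose e k : R := 1 / (2 ^ (k + 1))%:R.
have e0 k : 0 < e k by rewrite divr_gt0// ltr0n expn_gt0.
have e1 : (\sum_(0 <= k <oo) (e k)%:E < +oo)%E.
  by have /cvg_lim -> // := @cvg_geometric_eseries_half R 1 0; rewrite ltry.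
pose A k := projT1 (cid (H _ (e0 k))).
have hA k : [/\ measurable (A k), (mu1 (A k) <= (e k)%:E)%E & (mu2 (~` A k) <= (e k)%:E)%E].
  exact: projT2 (cid (H _ (e0 k))).
have mA k : measurable (A k) by case: (hA k).
have null (mu : probability T R) (B : nat -> set T) : (forall k, measurable (B k)) ->
    (forall k, (mu (B k) <= (e k)%:E)%E) -> mu (lim_sup_set B) = 0%E.
  move=> mB hB; apply: lim_sup_set_cvg0 => //; apply: le_lt_trans e1.
  by apply: lee_nneseries => [k _ _|k _]; [exact: measure_ge0|exact: hB].
have mL (B : nat -> set T) : (forall k, measurable (B k)) -> measurable (lim_sup_set B).
  by move=> mB; apply: bigcap_measurable => // n _; exact: bigcup_measurable.
exists (lim_sup_set A); split; [exact: mL|by apply: null => // k; case: (hA k)|].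
apply/eqP; rewrite eq_le measure_ge0 andbT.
rewrite -(null mu2 (fun k => ~` A k)) => [|k|k]; [|exact: measurableC|by case: (hA k)].
apply: le_measure; rewrite ?inE; [exact/measurableC/mL|by apply: mL => k; exact: measurableC|].
move=> w hw n _; apply: contrapT => hn; apply: hw => m _.
exists (maxn m n) => /=; first exact: leq_maxl.
by apply: contrapT => hA'; apply: hn; exists (maxn m n) => //=; exact: leq_maxr.
Qed.

(** * Quadratic variations of a Matern field *)

Section field_increments.
Context {R : realType} {disp : measure_display} {T : measurableType disp}.
Context {P : probability T R} {J : Type}.
Variable Y : J -> {RV P >-> R}.
Hypotheses (gY : gaussian_field Y) (Y0 : mean_zero Y).
Local Notation E X := (\int[P]_w X w).

Let EY t : E (Y t) = 0.
Proof. by have := Y0 t; rewrite unlock /Rintegral => ->. Qed.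

Let Y_gaussian t : is_gaussian (P := P) (Y t).
Proof.
have := gY 1%N (fun=> t) (fun=> 1); rewrite (_ : (fun w => _) = Y t)//.
by apply/funext => w; rewrite big_ord1 mul1r.
Qed.

Let iY t : P.-integrable setT (EFin \o Y t).
Proof. by have [] := centered_gaussian_moments P (Y t) (measurable_funPT (Y t)) (Y_gaussian t) (EY t). Qed.

Let iYY s t : P.-integrable setT (EFin \o (fun w => Y s w * Y t w)).
Proof.
have iY2 u : P.-integrable setT (EFin \o (fun w => Y u w ^+ 2)).
  by apply: centered_gaussian_sqr_integrable; [exact: measurable_funPT|exact: Y_gaussian|exact: EY].
exact: integrable_mulr_sqr (measurable_funPT (Y s)) (measurable_funPT (Y t)) (iY2 s) (iY2 t).
Qed.

Lemma covariance_mean_zero s t (k : R) : covariance P (Y s) (Y t) = k%:E -> E (fun w => Y s w * Y t w) = k.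
Proof.
rewrite covariance.unlock !Y0 /= expectation.unlock /Rintegral => H; rewrite -[k]/(fine k%:E) -H; congr fine.
by apply: eq_integral => w _; rewrite fctE /= !subr0.
Qed.

Variables (I : finType) (p : nat) (a : 'I_p -> R) (t : I -> 'I_p -> J).

Definition increment i w := \sum_j a j * Y (t i j) w.

Lemma measurable_increment i : measurable_fun setT (increment i).
Proof. by apply: measurable_sum => j; exact: measurable_funM. Qed.

Lemma increment_gaussian i j (b c : R) :
  is_gaussian (P := P) (fun w => b * increment i w + c * increment j w).
Proof.
(* The two families of points are concatenated into one of length 2 p, in which a point may be
   repeated. *)
have := gY (p + p)%N (fun k : 'I_(p + p) => match fintype.split k with inl l => t i l | inr l => t j l end)
  (fun k => match fintype.split k with inl l => b * a l | inr l => c * a l end).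
rewrite (_ : (fun w => \sum_(k < _) _) = (fun w => b * increment i w + c * increment j w))//.
apply/funext => w; rewrite big_split_ord /=; congr (_ + _); rewrite mulr_sumr; apply: eq_bigr => k _.
- by rewrite -[lshift _ _]/(unsplit (inl k)) unsplitK mulrA.
- by rewrite -[rshift _ _]/(unsplit (inr k)) unsplitK mulrA.
Qed.

Lemma integrable_increment i : P.-integrable setT (EFin \o increment i) /\ E (increment i) = 0.
Proof.
have [H1 H2] := Rintegral_lincomb P _ (index_enum 'I_p) a (fun j => Y (t i j)) (fun j => iY _).
by split; [exact: H1|rewrite [LHS]H2 big1// => j _; rewrite EY mulr0].
Qed.

Lemma increment_cov i j (K : J -> J -> R) : (forall s t, covariance P (Y s) (Y t) = (K s t)%:E) ->
  E (fun w => increment i w * increment j w) =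
  \sum_k \sum_l a k * a l * K (t i k) (t j l).
Proof.
move=> hK; pose c (kl : 'I_p * 'I_p) := a kl.1 * a kl.2.
have [_] := Rintegral_lincomb P _ (index_enum ('I_p * 'I_p)%type) c
  (fun kl w => Y (t i kl.1) w * Y (t j kl.2) w) (fun kl => iYY _ _).
rewrite (_ : (fun w => \sum_kl _) = (fun w => increment i w * increment j w)); last first.
  apply/funext => w; rewrite /increment big_distrlr pair_big /=.
  by apply: eq_bigr => kl _; rewrite /c mulrACA.
move=> ->; rewrite pair_big /=; apply: eq_bigr => kl _.
by rewrite (covariance_mean_zero _ _ _ (hK _ _)).
Qed.

Definition increment_cov_of (K : J -> J -> R) i j :=
  \sum_k \sum_l a k * a l * K (t i k) (t j l).

Lemma increment_chebyshev (K : J -> J -> R) (delta : R) :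
  (forall s t, covariance P (Y s) (Y t) = (K s t)%:E) -> 0 < delta ->
  (P [set w | (delta <= `|\sum_i increment i w ^+ 2 - \sum_i increment_cov_of K i i|)%R] <=
   (delta ^- 2 * (2 * \sum_i \sum_j increment_cov_of K i j ^+ 2))%:E)%E.
Proof.
move=> hK d0; have CE i j : E (fun w => increment i w * increment j w) = increment_cov_of K i j.
  exact: increment_cov.
have := @quadratic_statistic_chebyshev _ _ _ P I increment measurable_increment
  increment_gaussian (fun i => (integrable_increment i).1) (fun i => (integrable_increment i).2) delta d0.
rewrite (eq_bigr (fun i => increment_cov_of K i i)) => [|i _]; last exact: CE.
by under [in X in (_ <= X)%E -> _]eq_bigr do under eq_bigr do rewrite CE.
Qed.
End field_increments.
Arguments increment {R disp T P J} Y {I p} a t i w.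
Arguments increment_cov_of {R J I p} a t K i j.

Section matern_grid.
Context {R : realType} {d : nat}.

(** The base point [x0] cancels, and the change of scale eps^2 extracts eps^(2 nu) while alpha^2
    becomes alpha^2 eps^2. *)
Lemma matern_increment_cov (sigma alpha nu : R) (M : 'M[R]_d) (p : nat) (eps L : R)
    (x0 e : 'cV[R]_d) (pt : ('I_d -> nat) -> nat -> 'cV[R]_d) :
  0 < alpha -> 0 < nu -> 0 < eps ->
  (forall z j, pt z j = x0 + eps *: (grid_vec L z + j%:R *: e)) -> forall z w,
  \sum_(j < p.+1) \sum_(k < p.+1) diff_coef p j * diff_coef p k *
    matern sigma alpha nu (eucl_norm (M *m pt z j - M *m pt w k)) =
  sigma ^+ 2 * alpha `^ (2 * nu) / Gamma nu * (eps ^+ 2) `^ nu *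
    incr_mixture nu (alpha ^+ 2 * eps ^+ 2) p (M *m (grid_vec L z - grid_vec L w)) (M *m e).
Proof.
move=> a0 nu0 eps0 hpt z w; rewrite /incr_mixture mulr_sumr; apply: eq_bigr => j _.
rewrite mulr_sumr; apply: eq_bigr => k _.
rewrite matern_mixture ?eucl_norm_ge0// eucl_norm_sqr.
rewrite (mixture_shift _ _ _ (eps ^+ 2)) ?exprn_gt0//.
have -> : sqn (M *m pt z j - M *m pt w k) / 4 / eps ^+ 2 =
    sqn (M *m (grid_vec L z - grid_vec L w) + (j%:R - k%:R) *: (M *m e)) / 4.
  have -> : M *m pt z j - M *m pt w k =
      eps *: (M *m (grid_vec L z - grid_vec L w) + (j%:R - k%:R) *: (M *m e)).
    rewrite -mulmxBr !hpt scalemxAr -mulmxDr scalemxAr; congr (_ *m _).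
    apply/matrixP => i l; rewrite !mxE; ring.
  by rewrite sqnZ; field; rewrite gt_eqF.
ring.
Qed.
End matern_grid.

(** * Separation of the two means *)

Section separation.
Context {R : realType}.

(** If k1 and k2 differ, the difference stays away from 0 as h tends to 0, which is more than
    enough. If they are equal, the slope of G separates the values at b1 h and b2 h. *)
Lemma gram_mixture_separation (nu : R) (q : nat) (k1 k2 b1 b2 : R) :
  0 < nu -> 2 * nu + 2 <= q%:R -> 0 < k1 -> 0 < k2 -> 0 < b1 -> 0 < b2 ->
  (k1 != k2) || (b1 != b2) ->
  exists c h0 : R, [/\ 0 < c, 0 < h0 & forall h, 0 < h -> h <= h0 ->
    c * h <= `|k1 * gram_mixture nu (4 * q)%N (b1 * h) - k2 * gram_mixture nu (4 * q)%N (b2 * h)|].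
Proof.
move=> nu0 hq; have [G0 [C [c [G00 C0 c0 Gb Gd]]]] := gram_mixture_spec nu q nu0 hq.
set G := gram_mixture nu _ in Gb Gd *.
have main_k k1' k2' b1' b2' : 0 < k1' -> 0 < k2' -> 0 < b1' -> 0 < b2' -> k1' < k2' ->
   exists c h0 : R, [/\ 0 < c, 0 < h0 & forall h, 0 < h -> h <= h0 ->
    c * h <= k2' * G (b2' * h) - k1' * G (b1' * h)].
  (* D is the limit of the difference as h tends to 0; h <= D / K keeps the loss k2' C b2' h below D
     / 2, and h <= 1 turns D / 2 into a linear bound. *)
  move=> k10 k20 b10 b20 k12; pose D := (k2' - k1') * G0.
  have D0 : 0 < D by rewrite mulr_gt0// subr_gt0.
  pose K := 2 * (k2' * C * b2' + 1).
  have kCb : 0 <= k2' * C * b2' by rewrite !mulr_ge0// ltW.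
  have K0 : 0 < K by rewrite mulr_gt0// ltr_wpDl.
  exists (D / 2), (Num.min 1 (D / K)); split; first by rewrite divr_gt0.
    by rewrite lt_min ltr01 divr_gt0.
  move=> h h0; rewrite le_min => /andP[h1 hK].
  have /andP[g2 _] := Gb _ (mulr_gt0 b20 h0).
  have /andP[_ g1] := Gb _ (mulr_gt0 b10 h0).
  have e2 : k2' * (G0 - C * (b2' * h)) <= k2' * G (b2' * h) by rewrite ler_pM2l.
  have e1 : k1' * G (b1' * h) <= k1' * G0 by rewrite ler_pM2l.
  have e3 : h * K <= D by rewrite -ler_pdivlMr.
  have e4 : D / 2 * h <= D / 2 by rewrite ler_piMr// ltW// divr_gt0.
  have e5 : k2' * C * b2' * h <= D / 2.
    rewrite ler_pdivlMr// (le_trans _ e3)// /K mulrC [h * _]mulrC mulrA ler_wpM2r ?(ltW h0)//.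
    by rewrite ler_pM2l// lerDl.
  apply: (le_trans e4).
  have -> : D / 2 = D - D / 2 by field.
  rewrite /D in e5 *; lra.
move=> k10 k20 b10 b20; have [->|kN] /= := eqVneq k1 k2; last first.
  move=> _; have /orP[k12|k12] : (k1 < k2) || (k2 < k1) by rewrite -neq_lt.
    have [c' [h0 [c'0 h00 H]]] := main_k _ _ _ _ k10 k20 b10 b20 k12.
    exists c', h0; split=> // h hp hle; rewrite distrC.
    exact: le_trans (H h hp hle) (ler_norm _).
  have [c' [h0 [c'0 h00 H]]] := main_k _ _ _ _ k20 k10 b20 b10 k12.
  exists c', h0; split=> // h hp hle.
  exact: le_trans (H h hp hle) (ler_norm _).
have main_b b1' b2' : 0 < b1' -> b1' < b2' -> exists c h0 : R,
   [/\ 0 < c, 0 < h0 & forall h, 0 < h -> h <= h0 ->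
    c * h <= k2 * G (b1' * h) - k2 * G (b2' * h)].
  move=> b1'0 b12; have b2'0 := lt_trans b1'0 b12.
  (* The bound h <= 1 / b2' keeps both arguments of G in the range where its slope is controlled. *)
  exists (k2 * c * (b2' - b1')), b2'^-1; split.
  - by rewrite !mulr_gt0// subr_gt0.
  - by rewrite invr_gt0.
  move=> h hp hle; rewrite -mulrBr -!mulrA ler_pM2l// mulrBl.
  apply: Gd; rewrite ?mulr_gt0 ?ltr_pM2r//.
  by rewrite mulrC -ler_pdivlMr// mul1r.
move=> bN; have /orP[b12|b12] : (b1 < b2) || (b2 < b1) by rewrite -neq_lt.
  have [c' [h0 [c'0 h00 H]]] := main_b _ _ b10 b12.
  exists c', h0; split=> // h hp hle; exact: le_trans (H h hp hle) (ler_norm _).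
have [c' [h0 [c'0 h00 H]]] := main_b _ _ b20 b12.
exists c', h0; split=> // h hp hle; rewrite distrC.
exact: le_trans (H h hp hle) (ler_norm _).
Qed.

(** By polarization O = M1 M2^(-1) satisfies O^T O = rho I; determinants give rho^d = 1, so rho = 1
    because d > 0. *)
Lemma sqn_similarity (d : nat) (M1 M2 : 'M[R]_d) (rho : R) : (0 < d)%N ->
  SL R d M1 -> SL R d M2 -> 0 <= rho ->
  (forall e, sqn (M1 *m e) = rho * sqn (M2 *m e)) ->
  rho = 1 /\ exists O : 'M[R]_d, SO R d O /\ M1 = O *m M2.
Proof.
move=> d0 D1 D2 r0 H; rewrite /SL/= in D1 D2.
have u2 : M2 \in unitmx by rewrite unitmxE D2 unitr1.
pose O := M1 *m invmx M2.
have EO : M1 = O *m M2 by rewrite /O mulmxKV.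
have HO v : sqn (O *m v) = rho * sqn v.
  have <- : M1 *m (invmx M2 *m v) = O *m v by rewrite /O mulmxA.
  by rewrite H mulKVmx.
clearbody O; have sqnD (u v : 'cV[R]_d) : sqn (u + v) = sqn u + sqn v + 2 * \sum_i u i 0 * v i 0.
  rewrite /sqn mulr_sumr -!big_split /=; apply: eq_bigr => i _; rewrite !mxE; ring.
have ip (u v : 'cV[R]_d) : \sum_i (O *m u) i 0 * (O *m v) i 0 = rho * \sum_i u i 0 * v i 0.
  have := HO (u + v); rewrite mulmxDr !sqnD !HO => E.
  have : 2 * \sum_i (O *m u) i 0 * (O *m v) i 0 = 2 * (rho * \sum_i u i 0 * v i 0).
    move: E; lra.
  by move/mulfI; apply.
have OO : O^T *m O = rho%:M.
  apply/matrixP => i j; rewrite !mxE.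
  have := ip (delta_mx i 0) (delta_mx j 0); rewrite -!colE.
  under eq_bigr do rewrite !mxE.
  under [in RHS]eq_bigr do rewrite !mxE !eqxx !andbT.
  rewrite [in RHS](bigD1 i)//= eqxx mul1r [in RHS]big1 ?addr0; last first.
    by move=> k /negbTE ->; rewrite mul0r.
  move=> E; rewrite -[RHS]mulr_natr -E; apply: eq_bigr => k _; by rewrite !mxE.
have DO : \det O = 1.
  by have := D1; rewrite EO det_mulmx D2 mulr1.
have r1 : rho = 1.
  have := congr1 determinant OO; rewrite det_mulmx det_tr DO mulr1 det_scalar => /esym E.
  by apply/eqP; rewrite -(@pexpr_eq1 _ rho d)// ?E.
split=> //; exists O; split=> //; split=> //.
by rewrite OO r1.
Qed.

(** If no direction separates, the second equalities make M1 and M2 similar with ratio rho = (a2 /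
    a1)^2, and [sqn_similarity] yields a1 = a2 and a rotation. *)
Lemma separating_direction (d : nat) (nu s1 s2 a1 a2 : R) (M1 M2 : 'M[R]_d) : (0 < d)%N ->
  0 < nu -> 0 < s1 -> 0 < s2 -> 0 < a1 -> 0 < a2 -> SL R d M1 -> SL R d M2 ->
  (s1, a1) <> (s2, a2) \/ ~ (exists O : 'M[R]_d, SO R d O /\ M1 = O *m M2) ->
  exists2 e : 'cV[R]_d, e != 0 &
    (s1 ^+ 2 * a1 `^ (2 * nu) / Gamma nu * sqn (M1 *m e) `^ nu !=
     s2 ^+ 2 * a2 `^ (2 * nu) / Gamma nu * sqn (M2 *m e) `^ nu) ||
    (a1 ^+ 2 * sqn (M1 *m e) != a2 ^+ 2 * sqn (M2 *m e)).
Proof.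
move=> d0 nu0 s10 s20 a10 a20 D1 D2 H; apply: contrapT => N.
have G0 : 0 < Gamma nu by rewrite Gamma_mixture mixture_gt0.
have k0 (s a : R) : 0 < s -> 0 < a -> 0 < s ^+ 2 * a `^ (2 * nu) / Gamma nu.
  by move=> s0 a0; rewrite divr_gt0// mulr_gt0 ?exprn_gt0 ?powR_gt0.
have k10 := k0 _ _ s10 a10; have k20 := k0 _ _ s20 a20.
set k1 := _ / _ in k10 N; set k2 := _ / _ in k20 N.
have {}N e : e != 0 -> k1 * sqn (M1 *m e) `^ nu = k2 * sqn (M2 *m e) `^ nu /\
    a1 ^+ 2 * sqn (M1 *m e) = a2 ^+ 2 * sqn (M2 *m e).
  move=> e0; split; apply/eqP; apply: contrapT => /negP E; apply: N; exists e => //.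
    by rewrite E.
  by rewrite E orbT.
pose rho := (a2 / a1) ^+ 2.
have a1N : a1 != 0 by rewrite gt_eqF.
have [rho1 ex] : rho = 1 /\ exists O : 'M[R]_d, SO R d O /\ M1 = O *m M2.
  apply: sqn_similarity => //; first exact: sqr_ge0.
  move=> e; have [->|e0] := eqVneq e 0.
    by rewrite !mulmx0 /sqn !big1 ?mulr0// => i _; rewrite mxE expr0n.
  have [_ E] := N e e0; rewrite /rho expr_div_n mulrAC -E; field.
  exact: a1N.
have a12 : a1 = a2.
  apply/eqP; rewrite eq_sym -(@eqrXn2 _ 2)// ?ltW//; apply/eqP.
  have := rho1; rewrite /rho expr_div_n => /(congr1 (fun x => x * a1 ^+ 2)).
  by rewrite divfK ?expf_neq0// mul1r.
case: H => [|/(_ ex)//]; apply; congr (_, _) => //.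
(* Only s1 = s2 is left to prove; the first equality at any nonzero vector gives it. *)
pose e : 'cV[R]_d := const_mx 1.
have e0 : e != 0.
  apply/eqP => /matrixP/(_ (Ordinal d0) 0)/eqP; by rewrite !mxE oner_eq0.
have [E1 E2] := N e e0.
have u2 : M2 \in unitmx by rewrite unitmxE D2 unitr1.
have S0 : 0 < sqn (M2 *m e).
  apply: sqn_gt0; apply: contra e0 => /eqP E.
  by rewrite -(mulKmx u2 e) E mulmx0.
have ES : sqn (M1 *m e) = sqn (M2 *m e).
  by move: E2; rewrite a12 => /mulfI; apply; rewrite expf_neq0// -a12.
move: E1; rewrite ES => /mulIf; rewrite gt_eqF ?powR_gt0// => /(_ isT).
rewrite /k1 /k2 a12 => /mulIf; rewrite invr_eq0 gt_eqF// => /(_ isT).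
move=> /mulIf; rewrite gt_eqF ?powR_gt0// => /(_ isT) /eqP.
by rewrite eqrXn2 ?ltW// => /eqP.
Qed.
End separation.

(** * The grid inside the open set and the variance of the statistic *)

Lemma measurable_path_coord (I : Type) (R : realType) (i : I) :
  measurable_fun setT (fun f : path_space I R => f i).
Proof.
move=> _ B mB; rewrite setTI; apply: sub_sigma_algebra.
by exists i => //; exists B => //; rewrite setTI.
Qed.

(** Distributivity turns the sum over the grid into a product of d one-dimensional sums, so the
    bound depends neither on n nor on w. *)
Lemma sum_prod_decay (R : realType) (d n : nat) (c S : R) (w : {ffun 'I_d -> 'I_n}) :
  0 < c ->
  (forall n k, (k < n)%N -> \sum_(j < n) decay c (j%:R - k%:R) ^+ 2 <= S) ->
  \sum_(z : {ffun 'I_d -> 'I_n}) (\prod_(i < d) decay c ((z i)%:R - (w i)%:R)) ^+ 2 <= S ^+ d.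
Proof.
move=> c0 hS; under eq_bigr do rewrite -prodrXl.
rewrite -(bigA_distr_bigA (fun (i : 'I_d) (j : 'I_n) => decay c (j%:R - (w i)%:R) ^+ 2)).
rewrite -[d in leRHS]card_ord -prodr_const; apply: ler_prod => i _.
by rewrite hS// sumr_ge0// => j _; exact: sqr_ge0.
Qed.

Lemma open_grid (R : realType) (d p : nat) (e : 'cV[R]_d) (Omega : set 'cV[R]_d) (L : R) : open Omega -> Omega !=set0 -> 0 <= L ->
  exists2 r : R, 0 < r & exists x0 : 'cV[R]_d,
  forall (n : nat) (z : {ffun 'I_d -> 'I_n.+1}) (j : 'I_p.+1),
    Omega (x0 + (r / n.+1%:R) *: (grid_vec L (fun i => z i) + j%:R *: e)).
Proof.
move=> oO [x0 Ox0] L0.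
(* Balls of column vectors are for the maximum norm, hence a condition on each coordinate. *)
have [r r0 hr] : exists2 r : R, 0 < r & forall v : 'cV[R]_d, (forall i, `|v i 0| < r) -> Omega (x0 + v).
  have /nbhs_ballP[r r0 hr] := open_nbhs_nbhs (conj oO Ox0).
  exists r => // v hv; apply: hr; split => // i j; rewrite ord1 /ball /= !mxE opprD addNKr normrN.
  exact: hv.
pose K := \sum_i `|e i 0|; have K0 : 0 <= K by exact: sumr_ge0.
(* Before scaling, the coordinates are at most (n + 1) (D - 1); scaled by r / (D (n + 1)) they
   become at most r - r / D < r. *)
pose D := L + p%:R * K + 1; have D0 : 0 < D by rewrite ltr_wpDl// addr_ge0// mulr_ge0.
exists (r / D); first by rewrite divr_gt0.
exists x0 => n z j; apply: hr => i; rewrite !mxE normrM.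
have n0 : 0 < n.+1%:R :> R by rewrite ltr0n.
rewrite ger0_norm ?divr_ge0 ?(ltW r0) ?(ltW D0)//.
apply: (@le_lt_trans _ _ (r / D / n.+1%:R * (n.+1%:R * (D - 1)))).
  rewrite ler_wpM2l ?divr_ge0 ?(ltW r0) ?(ltW D0)//.
  rewrite /D addrK mulrDr (le_trans (ler_normD _ _))// lerD//.
    rewrite normrM ger0_norm// normr_nat mulrC ler_wpM2r// ler_nat ltnW//.
  rewrite normrM normr_nat mulrCA; apply: ler_pM => //.
    by rewrite ler_nat -ltnS.
  rewrite -[leLHS]mul1r ler_pM// ?ler1n//.
  by rewrite /K (bigD1 i)//= lerDl sumr_ge0.
rewrite mulrA divfK ?gt_eqF// mulrBr mulr1 divfK ?gt_eqF//.
by rewrite gtrBl divr_gt0.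
Qed.

Section grid_covariance.
Context {R : realType} {d : nat}.
Variables (nu : R) (nu0 : 0 < nu) (q : nat) (hq : 2 * nu + 1 + d%:R <= q%:R).
Local Notation p := (4 * q)%N.

(** For each w the sum over z is bounded by a constant, and there are n^d choices of w: the variance
    grows only like the number of segments. *)
Lemma grid_covariance_bound (M : 'M[R]_d) (e : 'cV[R]_d) (L : R) : M \in unitmx -> e != 0 ->
  (forall (z w : 'I_d -> nat) j k, (j <= p)%N -> (k <= p)%N ->
    \sum_i ((z i)%:R - (w i)%:R) ^+ 2 <= sqn (grid_vec L z - grid_vec L w + (j%:R - k%:R) *: e)) ->
  exists2 B : R, 0 <= B & forall (b : R) n, 0 < b ->
    \sum_(z : {ffun 'I_d -> 'I_n}) \sum_(w : {ffun 'I_d -> 'I_n})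
      incr_mixture nu b p (M *m (grid_vec L (fun i => z i) - grid_vec L (fun i => w i))) (M *m e) ^+ 2
    <= B * n%:R ^+ d.
Proof.
move=> uM e0 hL; have [c c0 hc] := sqn_mulmx_lb M uM.
have Me0 : M *m e != 0.
  by apply: contra e0 => /eqP E; rewrite -(mulKmx uM e) E mulmx0.
have [|C C0 hC] := @incr_mixture_grid R d nu c q M e L nu0 Me0 (ltW c0) hq.
  move=> z w j k jp kp; rewrite scalemxAr -mulmxDr.
  by apply: le_trans (hc _); rewrite ler_wpM2l ?(ltW c0)// hL.
have c80 : 0 < c / 8 by rewrite divr_gt0.
have [S S0 hS] := @sum_decay_le R (c / 8) c80.
exists (C ^+ 2 * S ^+ d) => [|b n b0]; first by rewrite mulr_ge0 ?sqr_ge0 ?exprn_ge0.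
apply: (@le_trans _ _ (\sum_(w : {ffun 'I_d -> 'I_n}) C ^+ 2 * S ^+ d)).
  rewrite exchange_big; apply: ler_sum => w _.
  apply: (@le_trans _ _ (\sum_(z : {ffun 'I_d -> 'I_n}) C ^+ 2 *
      (\prod_(i < d) decay (c / 8) ((z i)%:R - (w i)%:R)) ^+ 2)).
    apply: ler_sum => z _; rewrite -exprMn -[leLHS]real_normK ?num_real//.
    rewrite lerXn2r ?nnegrE//; last exact: hC.
    by rewrite mulr_ge0// prodr_ge0// => i _; rewrite invr_ge0 addr_ge0// mulr_ge0 ?sqr_ge0// ltW.
  by rewrite -mulr_sumr ler_wpM2l ?sqr_ge0// sum_prod_decay.
by rewrite sumr_const card_ffun !card_ord -natrX mulr_natr.
Qed.
End grid_covariance.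

Section matern_statistic_bound.
Context {R : realType} {d : nat} {disp : measure_display} {T : measurableType disp}.
Context {P : probability T R} {Omega : set 'cV[R]_d}.
Variables (nu : R) (nu0 : 0 < nu) (p : nat).
Variables (sigma alpha : R) (alpha0 : 0 < alpha) (M : 'M[R]_d) (uM : M \in unitmx).
Variables (Y : Omega -> {RV P >-> R}) (mY : matern_field sigma alpha nu M Y).
Variables (e : 'cV[R]_d) (e0 : e != 0) (L : R).

Let kappa := sigma ^+ 2 * alpha `^ (2 * nu) / Gamma nu.

(** All n^d increments have the same variance, given by [incr_mixture0], whence the centering. The
    hypothesis on B is used at b = alpha^2 eps^2, so B must not depend on b. *)
Lemma matern_statistic_bound (B eps delta : R) (n : nat) (x0 : 'cV[R]_d)
    (t : {ffun 'I_d -> 'I_n} -> 'I_p.+1 -> Omega) :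
  (forall (b : R), 0 < b ->
    \sum_(z : {ffun 'I_d -> 'I_n}) \sum_(w : {ffun 'I_d -> 'I_n})
      incr_mixture nu b p (M *m (grid_vec L (fun i => z i) - grid_vec L (fun i => w i))) (M *m e) ^+ 2
    <= B * n%:R ^+ d) ->
  0 < eps -> 0 < delta ->
  (forall z j, set_val (t z j) = x0 + eps *: (grid_vec L (fun i => z i) + j%:R *: e)) ->
  (P [set w | (delta <= `|\sum_z increment Y (fun j : 'I_p.+1 => diff_coef p j) t z w ^+ 2 -
      n%:R ^+ d * ((eps ^+ 2) `^ nu * (kappa * sqn (M *m e) `^ nu *
        gram_mixture nu p (alpha ^+ 2 * sqn (M *m e) * eps ^+ 2)))|)%R] <=
   (delta ^- 2 * (2 * ((kappa * (eps ^+ 2) `^ nu) ^+ 2 * (B * n%:R ^+ d))))%:E)%E.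
Proof.
move=> hB eps0 d0 ht; have [gY Y0 covY] := mY.
pose K s t := matern sigma alpha nu (eucl_norm (M *m set_val (s : Omega) - M *m set_val (t : Omega))).
have := @increment_chebyshev _ _ _ P Omega Y gY Y0 _ p.+1 (fun j : 'I_p.+1 => diff_coef p j) t K delta covY d0.
have Me0 : M *m e != 0.
  by apply: contra e0 => /eqP E; rewrite -(mulKmx uM e) E mulmx0.
pose pt (z : 'I_d -> nat) (j : nat) := x0 + eps *: (grid_vec L z + j%:R *: e).
have CE z w : increment_cov_of (fun j : 'I_p.+1 => diff_coef p j) t K z w =
    kappa * (eps ^+ 2) `^ nu * incr_mixture nu (alpha ^+ 2 * eps ^+ 2) p
      (M *m (grid_vec L (fun i => z i) - grid_vec L (fun i => w i))) (M *m e).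
  have <- := matern_increment_cov sigma alpha nu M p eps L x0 e pt alpha0 nu0 eps0 (fun _ _ => erefl)
    (fun i => z i) (fun i => w i).
  by apply: eq_bigr => j _; apply: eq_bigr => k _; rewrite /K !ht.
have -> : \sum_z increment_cov_of (fun j : 'I_p.+1 => diff_coef p j) t K z z =
    n%:R ^+ d * ((eps ^+ 2) `^ nu * (kappa * sqn (M *m e) `^ nu *
        gram_mixture nu p (alpha ^+ 2 * sqn (M *m e) * eps ^+ 2))).
  under eq_bigr do rewrite CE subrr mulmx0 incr_mixture0//.
  rewrite sumr_const card_ffun !card_ord -[LHS]mulr_natl natrX.
  congr (_ * _); rewrite (mulrAC (alpha ^+ 2)) /gram_mixture.
  by rewrite [kappa * _]mulrC !mulrA.
move=> /le_trans; apply; rewrite lee_fin ler_wpM2l ?invr_ge0 ?sqr_ge0// ler_wpM2l//.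
under eq_bigr do under eq_bigr do rewrite CE exprMn.
under eq_bigr do rewrite -mulr_sumr.
rewrite -mulr_sumr ler_wpM2l ?sqr_ge0//.
by apply: hB; rewrite mulr_gt0 ?exprn_gt0.
Qed.
End matern_statistic_bound.

(** * The tests and their error probabilities *)

Theorem corollary3 (R : realType) (d : nat) (hd : (4 < d)%N)
    (Omega : set 'cV[R]_d) (Omega_neq0 : Omega !=set0)
    (Omega_bounded : bounded_set Omega) (Omega_open : open Omega)
    (nu sigma1 sigma2 alpha1 alpha2 : R) (nu_gt0 : 0 < nu)
    (sigma1_gt0 : 0 < sigma1) (sigma2_gt0 : 0 < sigma2)
    (alpha1_gt0 : 0 < alpha1) (alpha2_gt0 : 0 < alpha2)
    (M1 M2 : 'M[R]_d) (M1_SL : SL R d M1) (M2_SL : SL R d M2)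
    (disp1 disp2 : measure_display)
    (T1 : measurableType disp1) (T2 : measurableType disp2)
    (P1 : probability T1 R) (P2 : probability T2 R)
    (Y1 : Omega -> {RV P1 >-> R}) (Y2 : Omega -> {RV P2 >-> R})
    (Y1_matern : matern_field sigma1 alpha1 nu M1 Y1)
    (Y2_matern : matern_field sigma2 alpha2 nu M2 Y2) :
  (sigma1, alpha1) <> (sigma2, alpha2) \/
  ~ (exists O : 'M[R]_d, SO R d O /\ M1 = O *m M2) ->
  mutually_singular (law Y1) (law Y2).
Proof.
move=> H; have d0 : (0 < d)%N by exact: leq_ltn_trans hd.
have [e e0 sep] := separating_direction d nu _ _ _ _ M1 M2 d0 nu_gt0 sigma1_gt0 sigma2_gt0
  alpha1_gt0 alpha2_gt0 M1_SL M2_SL H.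
have u1 : M1 \in unitmx by rewrite unitmxE M1_SL unitr1.
have u2 : M2 \in unitmx by rewrite unitmxE M2_SL unitr1.
have Me_gt0 (M : 'M[R]_d) : M \in unitmx -> 0 < sqn (M *m e).
  move=> uM; apply: sqn_gt0; apply: contra e0 => /eqP E.
  by rewrite -(mulKmx uM e) E mulmx0.
have Gamma_gt0 : 0 < Gamma nu by rewrite Gamma_mixture mixture_gt0.
set kap1 := sigma1 ^+ 2 * alpha1 `^ (2 * nu) / Gamma nu in sep.
set kap2 := sigma2 ^+ 2 * alpha2 `^ (2 * nu) / Gamma nu in sep.
have kap1_gt0 : 0 < kap1 by rewrite divr_gt0// mulr_gt0 ?exprn_gt0 ?powR_gt0.
have kap2_gt0 : 0 < kap2 by rewrite divr_gt0// mulr_gt0 ?exprn_gt0 ?powR_gt0.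
have [q hq] : exists q : nat, 2 * nu + 1 + d%:R <= q%:R.
  by exists (Num.truncn (2 * nu + 1 + d%:R)).+1; apply/ltW/truncnS_gt.
have [p pE] : exists p : nat, (4 * q)%N = p by exists (4 * q)%N.
have hq2 : 2 * nu + 2 <= q%:R.
  apply: le_trans hq; rewrite -addrA lerD2l (_ : 2 = 1 + 1)// lerD2l ler1n//.
have [c [h0 [c0 h00 Hsep]]] := gram_mixture_separation nu q (kap1 * sqn (M1 *m e) `^ nu)
  (kap2 * sqn (M2 *m e) `^ nu) (alpha1 ^+ 2 * sqn (M1 *m e)) (alpha2 ^+ 2 * sqn (M2 *m e))
  nu_gt0 hq2 (mulr_gt0 kap1_gt0 (powR_gt0 _ (Me_gt0 _ u1))) (mulr_gt0 kap2_gt0 (powR_gt0 _ (Me_gt0 _ u2)))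
  (mulr_gt0 (exprn_gt0 2 alpha1_gt0) (Me_gt0 _ u1)) (mulr_gt0 (exprn_gt0 2 alpha2_gt0) (Me_gt0 _ u2)) sep.
have [L L0 hL] := grid_sep (4 * q)%N e.
have [B1 B10 hB1] := grid_covariance_bound nu nu_gt0 q hq M1 e L u1 e0 hL.
have [B2 B20 hB2] := grid_covariance_bound nu nu_gt0 q hq M2 e L u2 e0 hL.
have [r r0 [x0 hpt]] := open_grid _ _ p e Omega L Omega_open Omega_neq0 L0.
(* Chebyshev's inequality at distance [delta] leaves 8 kap^2 B / (c^2 N h^2), where N h^2 >= r^4 (n
   + 1). Hence Q / (n + 1) bounds the error for both fields. *)
pose Q := 8 * (kap1 ^+ 2 * B1 + kap2 ^+ 2 * B2) / c ^+ 2 / r ^+ 4.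
have Q0 : 0 <= Q.
  by rewrite !divr_ge0 ?exprn_ge0 ?(ltW c0) ?(ltW r0)// mulr_ge0// addr_ge0// mulr_ge0// sqr_ge0.
rewrite pE in Hsep hB1 hB2.
apply: mutually_singular_approx => eta eta0.
(* The first summand makes the error at most [eta]; the second makes h = r^2 / (n + 1)^2 at most
   [h0]. *)
have [n hn] : exists n : nat, Q / eta + r ^+ 2 / h0 < n.+1%:R.
  by exists (Num.truncn (Q / eta + r ^+ 2 / h0)); exact: truncnS_gt.
have nQ : Q / eta <= n.+1%:R.
  by rewrite (le_trans _ (ltW hn))// lerDl divr_ge0 ?sqr_ge0// ltW.
have nh : r ^+ 2 / h0 <= n.+1%:R.
  by rewrite (le_trans _ (ltW hn))// lerDr divr_ge0// ltW.
have n0 : 0 < n.+1%:R :> R by rewrite ltr0n.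
have n1 : 1 <= n.+1%:R :> R by rewrite ler1n.
pose eps := r / n.+1%:R; have eps0 : 0 < eps by rewrite divr_gt0.
pose h := eps ^+ 2; have h_gt0 : 0 < h by rewrite exprn_gt0.
have hh0 : h <= h0.
  rewrite /h /eps expr_div_n ler_pdivrMr ?exprn_gt0//.
  move: nh; rewrite ler_pdivrMr// mulrC => /le_trans; apply.
  by rewrite ler_pM2l// expr2 ler_peMl// ltW.
pose t (z : {ffun 'I_d -> 'I_n.+1}) (j : 'I_p.+1) : Omega := SigSub (mem_set (hpt n z j)).
have ht z j : set_val (t z j) = x0 + eps *: (grid_vec L (fun i => z i) + j%:R *: e) by [].
pose N : R := n.+1%:R ^+ d; have N0 : 0 < N by rewrite exprn_gt0.
pose m (k b : R) := N * (h `^ nu * (k * gram_mixture nu p (b * h))).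
pose m1 := m (kap1 * sqn (M1 *m e) `^ nu) (alpha1 ^+ 2 * sqn (M1 *m e)).
pose m2 := m (kap2 * sqn (M2 *m e) `^ nu) (alpha2 ^+ 2 * sqn (M2 *m e)).
(* Half of the guaranteed gap between the means [m1] and [m2]. *)
pose delta := N * (h `^ nu * (c * h)) / 2.
have hnu : 0 < h `^ nu by rewrite powR_gt0.
have delta0 : 0 < delta by rewrite divr_gt0 ?mulr_gt0.
have sep_m : 2 * delta <= `|m1 - m2|.
  rewrite /delta mulrC divfK// /m1 /m2 /m -mulrBr -mulrBr normrM normrM.
  by rewrite (gtr0_norm N0) (gtr0_norm hnu) ler_pM2l// ler_pM2l// Hsep.
(* The statistic as a function of the path alone, so that one set serves both laws. *)
pose F (f : path_space Omega R) := \sum_z (\sum_(j < p.+1) diff_coef p j * f (t z j)) ^+ 2.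
have mF : measurable_fun setT F.
  apply: measurable_sum => z; apply: measurable_funX; apply: measurable_sum => j.
  by apply: measurable_funM => //; exact: measurable_path_coord.
have bound (kap B : R) : kap ^+ 2 * B <= kap1 ^+ 2 * B1 + kap2 ^+ 2 * B2 ->
   delta ^- 2 * (2 * ((kap * h `^ nu) ^+ 2 * (B * N))) <= eta.
  move=> kB.
  have -> : delta ^- 2 * (2 * ((kap * h `^ nu) ^+ 2 * (B * N))) =
      8 * (kap ^+ 2 * B) / c ^+ 2 / (N * h ^+ 2).
    by rewrite /delta; field; rewrite !gt_eqF.
  (* The exponent d - 4 is at least 1: this is where d > 4 makes the error tend to 0. *)
  have Nh : r ^+ 4 * n.+1%:R <= N * h ^+ 2.
    have -> : N * h ^+ 2 = r ^+ 4 * n.+1%:R ^+ (d - 4).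
      rewrite /N /h /eps -{1}(subnK (ltnW hd)) exprD.
      by move: (n.+1%:R ^+ (d - 4)) => X; field; rewrite gt_eqF.
    by rewrite ler_pM2l ?exprn_gt0// -{1}[n.+1%:R]expr1 ler_weXn2l// subn_gt0.
  have QE : 8 * (kap ^+ 2 * B) / c ^+ 2 <= Q * r ^+ 4.
    by rewrite divfK ?expf_neq0 ?gt_eqF// ler_wpM2r ?invr_ge0 ?sqr_ge0// ler_pM2l.
  rewrite ler_pdivrMr ?mulr_gt0 ?exprn_gt0//.
  apply: (le_trans QE); apply: (@le_trans _ _ (eta * n.+1%:R * r ^+ 4)).
    by rewrite ler_wpM2r ?exprn_ge0 ?(ltW r0)// mulrC -ler_pdivrMr.
  by rewrite -mulrA ler_pM2l// mulrC.
have far (a b y : R) : 2 * delta <= `|a - b| -> `|y - b| < delta -> delta <= `|y - a|.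
  move=> hab yb; rewrite leNgt; apply/negP => ya; move: hab; rewrite leNgt => /negP; apply.
  rewrite (_ : a - b = - (y - a) + (y - b)); last by ring.
  by rewrite (le_lt_trans (ler_normD _ _))// normrN mulr_natl mulr2n ltrD.
have mFm k : measurable [set f | delta <= `|F f - k|].
  have -> : [set f | delta <= `|F f - k|] = setT `&` (fun f => `|F f - k|) @^-1` `[delta, +oo[.
    by apply/seteqP; split => f /=; rewrite in_itv/= andbT; [move=> ?; split | case].
  have mg : measurable_fun setT (fun f => `|F f - k|).
    by apply: measurableT_comp; [exact: normr_measurable | exact: measurable_funB].
  exact: mg.
(* Evaluated on a sample path, F is the sum of squared increments, so this law is the probability
   bounded by [matern_statistic_bound]. *)
have hP1 : (law Y1 [set f | (delta <= `|F f - m1|)%R] <= eta%:E)%E.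
  apply: le_trans (matern_statistic_bound nu nu_gt0 p sigma1 alpha1 alpha1_gt0 M1 u1 Y1 Y1_matern
    e e0 L B1 eps delta n.+1 x0 t (fun b => hB1 b n.+1) eps0 delta0 ht) _.
  by rewrite lee_fin bound// lerDl mulr_ge0// sqr_ge0.
have hP2 : (law Y2 [set f | (delta <= `|F f - m2|)%R] <= eta%:E)%E.
  apply: le_trans (matern_statistic_bound nu nu_gt0 p sigma2 alpha2 alpha2_gt0 M2 u2 Y2 Y2_matern
    e e0 L B2 eps delta n.+1 x0 t (fun b => hB2 b n.+1) eps0 delta0 ht) _.
  by rewrite lee_fin bound// lerDr mulr_ge0// sqr_ge0.
(* The paths whose statistic is within [delta] of [m2]. By [far] they are at least [delta] away from
   [m1], which is unlikely under the first law. *)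
exists (~` [set f | delta <= `|F f - m2|]); split; [exact: measurableC| |by rewrite setCK].
apply: le_trans hP1.
apply: le_measure (mem_set (measurableC (mFm m2))) (mem_set (mFm m1)) _ => f /= /negP; rewrite -ltNge => Fm2.
exact: far sep_m Fm2.
Qed.
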